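(* Let $T>0$ and let $H,m_0,m_T$ satisfy the standing assumptions of the context (in which $m_T$ is not required to be positive). Assume that $H(0,0)<\infty$, and that $m_T(x_0)<0$ for some $x_0\in\mathbb T$. Then there exists $C>0$ such that, for all $0<\epsilon<\frac1C$, there exists no classical solution to the system $$\begin{cases}-u^\epsilon_t+H(u^\epsilon_x,m^\epsilon)=0&\text{in }Q_T,\\ m^\epsilon_t-(m^\epsilon H_p(u^\epsilon_x,m^\epsilon))_x=0&\text{in }Q_T,\\ m^\epsilon(x,0)=m_0(x),\quad\epsilon u^\epsilon(x,T)=m^\epsilon(x,T)-m_T(x)&x\in\mathbb T.\end{cases}$$
   Context: $\mathbb T$ is the one-dimensional torus (of length 1), $Q_T=\mathbb T\times(0,T)$, $\overline{Q_T}=\mathbb T\times[0,T]$. $H=H(p,m):\mathbb R\times(0,\infty)\to\mathbb R$; subscripts $t,x,p,m$ denote partial derivatives; $H(0,0):=\lim_{m\to0^+}H(0,m)$, which exists in $(-\infty,+\infty]$ because $H_m<0$. A classical solution is a pair $(u^\epsilon,m^\epsilon)\in C^2(\overline{Q_T})\times C^1(\overline{Q_T})$ with $m^\epsilon>0$ satisfying the equations pointwise. $C_0>0$, $\gamma>1$, $0<\alpha<1$ are constants and $\overline C:(0,\infty)\to(0,\infty)$ is a continuous function. Standing assumptions: (M') $m_0,m_T\in C^{2,\alpha}(\mathbb T)$, $m_0>0$, $\int_{\mathbb T}m_0=\int_{\mathbb T}m_T=1$. (H) $H,H_p,H_{pp}\in C^4(\mathbb R\times(0,\infty))$, $H_m<0$,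 and for all $(p,m)\in\mathbb R\times(0,\infty)$: $\frac1{C_0}(1+|p|)^{\gamma-2}\le H_{pp}\le\overline C(m)(1+|p|)^{\gamma-2}$; $pH_p\ge(1+\frac1{C_0})H-\overline C(m)$; $|H_{ppp}|\le\overline C(m)(1+|p|)^{\gamma-3}$; $|H_m|\le\overline C(m)(1+|p|)^\gamma$; $m|H_{mm}|\le-\overline C(m)H_m$; $|p||H_{mp}|\le-\overline C(m)H_m$; $m|p||H_{mmp}|\le-\overline C(m)H_m$; $|H_{mpp}|\le\overline C(m)(1+|p|)^{\gamma-2}$. (E) $-4mH_mH_{pp}\ge(1+\frac1{C_0})m^2H_{mp}^2$ for all $(p,m)\in\mathbb R\times(0,\infty)$. *)

(* Defs.v *)
From Stdlib Require Import Reals.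
From Coquelicot Require Import Coquelicot.
Open Scope R_scope.

Definition D1 (f : R -> R -> R) : R -> R -> R :=
  fun x y => Derive (fun s => f s y) x.

Definition D2 (f : R -> R -> R) : R -> R -> R :=
  fun x y => Derive (fun s => f x s) y.

(** [Ck k S f]: [f] is of class C^k on [S], for [S] lying between an open set
    and its closure.  Differentiability is only required at interior points
    ([locally (x, y) S]); the partial derivatives up to order [k] must extend
    continuously to all of [S]. *)
Fixpoint Ck (k : nat) (S : R * R -> Prop) (f : R -> R -> R) : Prop :=
  continuous_on S (fun z => f (fst z) (snd z)) /\
  match k with
  | O => True
  | Datatypes.S k' =>
      exists f1 f2 : R -> R -> R,
        Ck k' S f1 /\ Ck k' S f2 /\
        forall x y : R, locally (x, y) S ->
          is_derive (fun s => f s y) x (f1 x y) /\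
          is_derive (fun s => f x s) y (f2 x y)
  end.

(** Functions on the torus of length 1 are 1-periodic functions on [R]. *)
Definition periodic1 (f : R -> R) : Prop := forall x : R, f (x + 1) = f x.

Definition half_plane (z : R * R) : Prop := 0 < snd z.

(** The lift to R x R of the closed cylinder over the torus. *)
Definition closed_strip (T : R) (z : R * R) : Prop := 0 <= snd z <= T.

(** C^{2,alpha} on the torus.  [ex_derive_n f k] only speaks of the last of the
    [k] derivatives, hence the quantification over [k].  For periodic functions
    the Hölder condition is the same for the distances of R and of the torus. *)
Definition C2_Holder (alpha : R) (f : R -> R) : Prop :=
  periodic1 f /\
  (forall (k : nat) (x : R), (k <= 2)%nat -> ex_derive_n f k x) /\
  (exists K : R, forall x y : R, x <> y ->
     Rabs (Derive_n f 2 x - Derive_n f 2 y) <= K * Rpower (Rabs (x - y)) alpha).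

Record assumption_M' (alpha : R) (m0 mT : R -> R) : Prop := {
  M'_m0_reg : C2_Holder alpha m0;
  M'_mT_reg : C2_Holder alpha mT;
  M'_m0_pos : forall x : R, 0 < m0 x;
  M'_m0_mass : RInt m0 0 1 = 1;
  M'_mT_mass : RInt mT 0 1 = 1
}.

(** For [H = H(p, m)]: [H_p = D1 H], [H_m = D2 H], [H_mp = D1 (D2 H)], etc. *)
Record assumption_H (C0 gamma : R) (Cbar : R -> R) (H : R -> R -> R) : Prop := {
  H_C4 : Ck 4 half_plane H;
  Hp_C4 : Ck 4 half_plane (D1 H);
  Hpp_C4 : Ck 4 half_plane (D1 (D1 H));
  Hm_neg : forall p m : R, 0 < m -> D2 H p m < 0;
  Hpp_lower : forall p m : R, 0 < m ->
    / C0 * Rpower (1 + Rabs p) (gamma - 2) <= D1 (D1 H) p m;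
  Hpp_upper : forall p m : R, 0 < m ->
    D1 (D1 H) p m <= Cbar m * Rpower (1 + Rabs p) (gamma - 2);
  pHp_lower : forall p m : R, 0 < m ->
    p * D1 H p m >= (1 + / C0) * H p m - Cbar m;
  Hppp_bound : forall p m : R, 0 < m ->
    Rabs (D1 (D1 (D1 H)) p m) <= Cbar m * Rpower (1 + Rabs p) (gamma - 3);
  Hm_bound : forall p m : R, 0 < m ->
    Rabs (D2 H p m) <= Cbar m * Rpower (1 + Rabs p) gamma;
  Hmm_bound : forall p m : R, 0 < m ->
    m * Rabs (D2 (D2 H) p m) <= - Cbar m * D2 H p m;
  Hmp_bound : forall p m : R, 0 < m ->
    Rabs p * Rabs (D1 (D2 H) p m) <= - Cbar m * D2 H p m;
  Hmmp_bound : forall p m : R, 0 < m ->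
    m * Rabs p * Rabs (D1 (D2 (D2 H)) p m) <= - Cbar m * D2 H p m;
  Hmpp_bound : forall p m : R, 0 < m ->
    Rabs (D1 (D1 (D2 H)) p m) <= Cbar m * Rpower (1 + Rabs p) (gamma - 2)
}.

Definition assumption_E (C0 : R) (H : R -> R -> R) : Prop :=
  forall p m : R, 0 < m ->
    - 4 * m * D2 H p m * D1 (D1 H) p m
      >= (1 + / C0) * m ^ 2 * (D1 (D2 H) p m) ^ 2.

Record classical_solution (T : R) (H : R -> R -> R) (m0 mT : R -> R) (eps : R)
    (u m : R -> R -> R) : Prop := {
  sol_u_per : forall t : R, 0 <= t <= T -> periodic1 (fun x => u x t);
  sol_m_per : forall t : R, 0 <= t <= T -> periodic1 (fun x => m x t);
  sol_u_C2 : Ck 2 (closed_strip T) u;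
  sol_m_C1 : Ck 1 (closed_strip T) m;
  sol_m_pos : forall x t : R, 0 <= t <= T -> 0 < m x t;
  sol_HJ : forall x t : R, 0 < t < T ->
    - D2 u x t + H (D1 u x t) (m x t) = 0;
  sol_FP : forall x t : R, 0 < t < T ->
    D2 m x t - D1 (fun y s => m y s * D1 H (D1 u y s) (m y s)) x t = 0;
  sol_init : forall x : R, m x 0 = m0 x;
  sol_term : forall x : R, eps * u x T = m x T - mT x
}.

(* Main.v *)
Require Import Defs.
From Stdlib Require Import Reals ZArith Lra Lia.
From Coquelicot Require Import Coquelicot.
Open Scope R_scope.

(** At the final time [m > 0] and [mT x0 < 0] force
    [eps * u x0 T > - mT x0], so [u] must be at least of order [1 / eps] there.
    On the other hand mass conservation gives [u] a zero mean over a period at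
    time [T], hence a point [y] with [u y T <= 0].  The contradiction comes from a
    bound on [u x0 T - u y T] that does not depend on [eps].

    All estimates follow from one comparison principle ([comparison_principle])
    for two solutions of the system, with no boundary condition on [u].
    Assumption (E), with [H_m < 0 < H_pp], makes the map sending [(m, p)] to
    [(- H, m * H_p)] strictly monotone, which is the Lasry-Lions condition
    ([assumption_H_monotone]).
    With [w = u1 - u2 - k], the energy given by the space integral of
    [(w^+)^2 * (m1 - m2)] therefore decreases in time.  If at time [0]
    one has [m1 <= m2] wherever [w > 0], and at time [T] one has [m1 >= m2]
    wherever [w > 0], then the energy vanishes identically, the two solutions have
    the same gradient and density on the set where [w > 0], and [(w^+)^2] is
    constant in space and time; it is zero as soon as [w <= 0] at one point.

    Three competitors are used.

    - Against the constant state of density [max m0]: since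
      [m = eps * u + mT] at time [T], the set where [u] is large there is a set
      where [m] is large, and [w <= 0] at the point [y].  This bounds
      [eps * u], hence [m], from above at time [T], uniformly in [eps]
      ([terminal_value_bound]).

    - Against its own translate along a vector [(v * h, h)].  At both ends of
      the time interval [m <= M], so [H(p, m) + v * p >= H(p, M) + v * p >= - C]
      because [H] decreases in [m] and is superlinear in [p].  Hence [u] cannot
      drop by more than [C * h] along this vector near the two ends; comparison
      carries this to all times, and adding up the steps gives
      [u z 0 <= u y T + C * T] with [v = (y - z) / T] ([transport_bound]).

    - Against the constant state of density [min m(., T)]: the maximum of [u]
      at time [T] exceeds that at time [0] by at most [T * sup H(0, .)], which
      is finite because [H(0, 0)] is ([terminal_le_initial_max]).

    Chaining the last two estimates bounds [u x0 T]. *)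

(** * Calculus in one and two variables *)

Lemma continuity_2d_pt_comp_2 (F f g : R -> R -> R) (x y : R) :
  continuity_2d_pt F (f x y) (g x y) ->
  continuity_2d_pt f x y -> continuity_2d_pt g x y ->
  continuity_2d_pt (fun a b => F (f a b) (g a b)) x y.
Proof.
  intros HF Hf Hg e.
  destruct (HF e) as [d Hd].
  destruct (Hf d) as [d1 H1].
  destruct (Hg d) as [d2 H2].
  exists (mkposreal _ (Rmin_pos _ _ (cond_pos d1) (cond_pos d2))); simpl.
  intros u v Hu Hv.
  apply Hd.
  - apply H1.
    + apply (Rlt_le_trans _ _ _ Hu), Rmin_l.
    + apply (Rlt_le_trans _ _ _ Hv), Rmin_l.
  - apply H2.
    + apply (Rlt_le_trans _ _ _ Hu), Rmin_r.
    + apply (Rlt_le_trans _ _ _ Hv), Rmin_r.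
Qed.

Lemma continuity_2d_pt_path (F : R -> R -> R) (a b : R -> R) (t : R) :
  continuity_2d_pt F (a t) (b t) ->
  continuous a t -> continuous b t -> continuous (fun s => F (a s) (b s)) t.
Proof.
  intros HF Ha Hb.
  apply continuous_comp_2 with (1 := Ha) (2 := Hb).
  now apply continuity_2d_pt_filterlim.
Qed.

Lemma continuity_2d_pt_swap (F : R -> R -> R) (x y : R) :
  continuity_2d_pt F x y -> continuity_2d_pt (fun a b => F b a) y x.
Proof.
  intros HF e.
  destruct (HF e) as [d Hd].
  exists d; intros u v Hu Hv; now apply Hd.
Qed.

Lemma is_derive_Rmult (f g : R -> R) (x df dg : R) :
  is_derive f x df -> is_derive g x dg ->
  is_derive (fun y => f y * g y) x (df * g x + f x * dg).
Proof.
  intros Hf Hg.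
  apply is_derive_Reals.
  apply (derivable_pt_lim_mult f g); now apply is_derive_Reals.
Qed.

Lemma is_derive_Rminus (f g : R -> R) (x df dg : R) :
  is_derive f x df -> is_derive g x dg ->
  is_derive (fun y => f y - g y) x (df - dg).
Proof. intros Hf Hg; exact (is_derive_minus f g x df dg Hf Hg). Qed.

Lemma is_derive_shift (f : R -> R) (a x l : R) :
  is_derive f (x + a) l -> is_derive (fun y => f (y + a)) x l.
Proof.
  intros Hf.
  replace l with (scal 1 l) by (unfold scal; simpl; unfold mult; simpl; ring).
  apply (is_derive_comp f (fun y => y + a)); [exact Hf|].
  auto_derive; [exact I | ring].
Qed.

Lemma nonincreasing_interior (f df : R -> R) (a b : R) :
  a <= b ->
  (forall x, a <= x <= b -> continuous f x) ->
  (forall x, a < x < b -> is_derive f x (df x)) ->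
  (forall x, a < x < b -> df x <= 0) ->
  f b <= f a.
Proof.
  intros Hab Hc Hd Hs.
  destruct (Rle_lt_or_eq_dec a b Hab) as [Hlt | ->]; [|lra].
  assert (Hsr : forall x, a < x < b -> Rmin (df x) 0 = df x).
  { intros x Hx; apply Rmin_left, Hs, Hx. }
  destruct (MVT_gen f a b (fun x => Rmin (df x) 0)) as [c [_ Hc']].
  - intros x Hx; rewrite Rmin_left, Rmax_right in Hx by lra.
    rewrite Hsr by exact Hx; now apply Hd.
  - intros x Hx; rewrite Rmin_left, Rmax_right in Hx by lra.
    apply continuity_pt_filterlim, Hc, Hx.
  - pose proof (Rmin_r (df c) 0); nra.
Qed.

Lemma constant_interior (f : R -> R) (a b : R) :
  a <= b ->
  (forall x, a <= x <= b -> continuous f x) ->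
  (forall x, a < x < b -> is_derive f x 0) ->
  f a = f b.
Proof.
  intros Hab Hc Hd.
  destruct (MVT_gen f a b (fun _ => 0)) as [c [_ Hc']].
  - intros x Hx; rewrite Rmin_left, Rmax_right in Hx by lra; now apply Hd.
  - intros x Hx; rewrite Rmin_left, Rmax_right in Hx by lra.
    apply continuity_pt_filterlim, Hc, Hx.
  - lra.
Qed.

Lemma ex_RInt_cont (f : R -> R) (a b : R) :
  (forall x, continuous f x) -> ex_RInt f a b.
Proof. intros Hf; apply (ex_RInt_continuous f); intros; apply Hf. Qed.

(** The primitive of a nonpositive function is monotone; if it returns to its
    starting value it is constant, and so its derivative vanishes. *)
Lemma RInt_zero_nonpos (f : R -> R) (a b c : R) :
  a < c < b -> (forall x, continuous f x) -> (forall x, f x <= 0) ->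
  RInt f a b = 0 -> f c = 0.
Proof.
  intros Hc Hf Hn HI.
  assert (Hz : forall x, a <= x <= b -> RInt f a x = 0).
  { intros x Hx.
    pose proof (RInt_Chasles f a x b (ex_RInt_cont f a x Hf) (ex_RInt_cont f x b Hf)) as HC.
    change (RInt f a x + RInt f x b = RInt f a b) in HC.
    assert (Hle : forall y z, y <= z -> RInt f y z <= 0).
    { intros y z Hyz.
      replace 0 with (RInt (fun _ => 0) y z)
        by (rewrite RInt_const; unfold scal; simpl; unfold mult; simpl; ring).
      apply RInt_le; auto.
      - now apply ex_RInt_cont.
      - apply ex_RInt_cont; intros; apply continuous_const. }
    pose proof (Hle a x (proj1 Hx)); pose proof (Hle x b (proj2 Hx)); lra. }
  assert (H1 : is_derive (RInt f a) c (f c)).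
  { apply (is_derive_RInt f (RInt f a) a c); [|apply Hf].
    apply filter_forall; intros x; apply (RInt_correct f), ex_RInt_cont, Hf. }
  assert (H2 : is_derive (RInt f a) c 0).
  { apply is_derive_ext_loc with (fun _ => 0); [|apply (is_derive_const (V := R_NormedModule))].
    assert (Hp : 0 < Rmin (c - a) (b - c)) by (apply Rmin_pos; lra).
    exists (mkposreal _ Hp); simpl.
    intros y Hy; apply Rabs_def2 in Hy; simpl in Hy.
    pose proof (Rmin_l (c - a) (b - c)); pose proof (Rmin_r (c - a) (b - c)).
    unfold minus, plus, opp in Hy; simpl in Hy.
    symmetry; apply Hz; lra. }
  rewrite <- (is_derive_unique _ _ _ H1); exact (is_derive_unique _ _ _ H2).
Qed.

Lemma continuous_RInt_param (f : R -> R -> R) (a b t : R) :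
  a <= b -> (forall x s, continuity_2d_pt f x s) ->
  continuous (fun s => RInt (fun x => f x s) a b) t.
Proof.
  intros Hab Hf.
  assert (Hs : forall s x, continuous (fun y => f y s) x).
  { intros s x; apply (continuity_2d_pt_path f (fun y => y) (fun _ => s));
      [apply Hf | apply continuous_id | apply continuous_const]. }
  apply continuity_pt_filterlim, continuity_pt_locally; intros e.
  assert (He : 0 < e / (b - a + 1)).
  { apply Rdiv_lt_0_compat; [apply cond_pos | lra]. }
  destruct (uniform_continuity_2d f a b (t - 1) (t + 1) (fun x s _ _ => Hf x s)
              (mkposreal _ He)) as [d Hd]; simpl in Hd.
  exists (mkposreal _ (Rmin_pos _ _ (cond_pos d) Rlt_0_1)).
  intros s Hst; unfold ball in Hst; simpl in Hst; unfold AbsRing_ball in Hst; simpl in Hst.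
  unfold abs, minus, plus, opp in Hst; simpl in Hst.
  pose proof (Rlt_le_trans _ _ _ Hst (Rmin_l _ _)) as Hst1.
  pose proof (Rlt_le_trans _ _ _ Hst (Rmin_r _ _)) as Hst2.
  apply Rabs_def2 in Hst2.
  pose proof (RInt_minus (fun x => f x s) (fun x => f x t) a b
    (ex_RInt_cont _ a b (Hs s)) (ex_RInt_cont _ a b (Hs t))) as HE.
  change (RInt (fun x => f x s - f x t) a b
    = RInt (fun x => f x s) a b - RInt (fun x => f x t) a b) in HE.
  rewrite <- HE.
  apply Rle_lt_trans with ((b - a) * (e / (b - a + 1))).
  - apply abs_RInt_le_const; [exact Hab | |].
    + apply ex_RInt_cont; intros x.
      apply (continuous_minus (V := R_NormedModule)); apply Hs.
    + intros x Hx; apply Rlt_le, Hd; try lra.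
      * rewrite Rminus_diag, Rabs_R0; apply cond_pos.
      * exact Hst1.
  - pose proof (cond_pos e).
    replace (pos e) with ((b - a + 1) * (e / (b - a + 1))) at 2 by (field; lra).
    apply Rmult_lt_compat_r; lra.
Qed.

Lemma is_derive_RInt_second (f g : R -> R -> R) (a b t : R) (d : posreal) :
  (forall x s, Rabs (s - t) < d -> is_derive (fun r => f x r) s (g x s)) ->
  (forall x, continuity_2d_pt g x t) ->
  (forall x s, continuity_2d_pt f x s) ->
  is_derive (fun s => RInt (fun x => f x s) a b) t (RInt (fun x => g x t) a b).
Proof.
  intros Hd Hg Hf.
  replace (RInt (fun x => g x t) a b)
    with (RInt (fun x => Derive (fun u => f x u) t) a b).
  2:{ apply RInt_ext; intros x _; apply is_derive_unique, Hd.
      rewrite Rminus_diag, Rabs_R0; apply cond_pos. }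
  apply (is_derive_RInt_param (fun s x => f x s)).
  - exists d; intros s Hs x _; exists (g x s); apply Hd, Hs.
  - intros x _.
    apply continuity_2d_pt_ext_loc with (fun s y => g y s).
    + exists d; intros u v Hu _; symmetry; apply is_derive_unique, Hd, Hu.
    + now apply continuity_2d_pt_swap.
  - apply filter_forall; intros s; apply ex_RInt_cont; intros x.
    apply (continuity_2d_pt_path f (fun y => y) (fun _ => s));
      [apply Hf | apply continuous_id | apply continuous_const].
Qed.

Lemma periodic_representative (f : R -> R) (a x : R) :
  periodic1 f -> exists y, a <= y <= a + 1 /\ f y = f x.
Proof.
  intros Hp.
  assert (Hn : forall n y, f (y + INR n) = f y).
  { induction n as [|n IH]; intros y.
    - now rewrite Rplus_0_r.
    - now rewrite S_INR, <- Rplus_assoc, Hp. }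
  assert (Hz : forall z y, f (y + IZR z) = f y).
  { intros z y; destruct (Z_le_gt_dec 0 z) as [Hz | Hz].
    - rewrite <- (Z2Nat.id z Hz), <- INR_IZR_INZ; apply Hn.
    - rewrite <- (Hn (Z.to_nat (- z)) (y + IZR z)), INR_IZR_INZ.
      rewrite Z2Nat.id, opp_IZR by lia; f_equal; ring. }
  exists (x + IZR (- Int_part (x - a))); split; [|apply Hz].
  rewrite opp_IZR; destruct (base_Int_part (x - a)); lra.
Qed.

Lemma periodic_max (f : R -> R) :
  periodic1 f -> (forall x, continuous f x) -> exists z, forall x, f x <= f z.
Proof.
  intros Hp Hc.
  destruct (continuity_ab_maj f 0 1) as [z [Hz _]]; [lra | |].
  - intros c _; apply continuity_pt_filterlim, Hc.
  - exists z; intros x.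
    destruct (periodic_representative f 0 x Hp) as [y [Hy <-]].
    apply Hz; lra.
Qed.

Lemma periodic_min (f : R -> R) :
  periodic1 f -> (forall x, continuous f x) -> exists z, forall x, f z <= f x.
Proof.
  intros Hp Hc.
  destruct (periodic_max (fun x => - f x)) as [z Hz].
  - intros x; now rewrite Hp.
  - intros x; apply (continuous_opp (V := R_NormedModule)), Hc.
  - exists z; intros x; specialize (Hz x); lra.
Qed.

(** Squaring the positive part makes the truncation continuously differentiable. *)
Definition pos_sq (z : R) : R := Rmax z 0 ^ 2.

Lemma is_derive_pos_sq (z : R) : is_derive pos_sq z (2 * Rmax z 0).
Proof.
  apply is_derive_Reals; intros e He.
  exists (mkposreal e He); simpl; intros h Hh Hhe.
  assert (Hq : Rabs (pos_sq (z + h) - pos_sq z - 2 * Rmax z 0 * h) <= h * h).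
  { unfold pos_sq.
    apply Rabs_le.
    unfold Rmax; destruct (Rle_dec (z + h) 0), (Rle_dec z 0); split; nra. }
  replace ((pos_sq (z + h) - pos_sq z) / h - 2 * Rmax z 0)
    with ((pos_sq (z + h) - pos_sq z - 2 * Rmax z 0 * h) / h) by (field; exact Hh).
  unfold Rdiv; rewrite Rabs_mult, Rabs_inv.
  apply Rle_lt_trans with (2 := Hhe).
  apply Rmult_le_reg_r with (Rabs h); [now apply Rabs_pos_lt|].
  rewrite Rmult_assoc, Rinv_l by now apply Rabs_no_R0.
  rewrite <- Rabs_mult, (Rabs_pos_eq (h * h)) by nra; lra.
Qed.

Lemma continuous_pos_sq (z : R) : continuous pos_sq z.
Proof.
  apply (ex_derive_continuous pos_sq); exists (2 * Rmax z 0); apply is_derive_pos_sq.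
Qed.

Lemma continuity_pos_part (z : R) : continuity_pt (fun y => 2 * Rmax y 0) z.
Proof.
  apply continuity_pt_ext with (fun y => y + Rabs y).
  - intros y; unfold Rmax, Rabs; destruct (Rle_dec y 0), (Rcase_abs y); lra.
  - apply continuity_pt_plus; [apply continuity_pt_id | apply Rcontinuity_abs].
Qed.

Lemma pos_sq_nonpos (z : R) : z <= 0 -> pos_sq z = 0.
Proof. intros Hz; unfold pos_sq; rewrite Rmax_right by lra; ring. Qed.

Lemma pos_sq_ge0 (z : R) : 0 <= pos_sq z.
Proof. unfold pos_sq; nra. Qed.

Lemma pos_sq_eq0 (z : R) : pos_sq z = 0 -> z <= 0.
Proof.
  intros Hz; unfold pos_sq in Hz; unfold Rmax in Hz; destruct (Rle_dec z 0); nra.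
Qed.
(** * The Hamiltonian *)

Lemma half_plane_locally (p m : R) : 0 < m -> locally (p, m) half_plane.
Proof.
  intros Hm; exists (mkposreal m Hm); intros [q n] [_ Hn]; simpl in Hn.
  apply Rabs_def2 in Hn; unfold half_plane; simpl.
  unfold minus, plus, opp in Hn; simpl in Hn; lra.
Qed.

Lemma Ck_continuity_2d (k : nat) (S : R * R -> Prop) (f : R -> R -> R) (x y : R) :
  Ck k S f -> locally (x, y) S -> continuity_2d_pt f x y.
Proof.
  intros Hf HS; apply continuity_2d_pt_filterlim.
  assert (Hc : continuous_on S (fun z => f (fst z) (snd z))) by (destruct k; apply Hf).
  exact (continuous_continuous_on S _ (x, y) HS Hc).
Qed.

Lemma Ck_ext (k : nat) (f g : R -> R -> R) :
  (forall p m, 0 < m -> f p m = g p m) -> Ck k half_plane f -> Ck k half_plane g.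
Proof.
  intros Hfg Hf.
  assert (Hc : continuous_on half_plane (fun z => g (fst z) (snd z))).
  { apply continuous_on_ext with (fun z => f (fst z) (snd z)).
    - intros [p m] Hm; now apply Hfg.
    - destruct k; apply Hf. }
  destruct k as [|k]; [now split|].
  destruct Hf as [_ [f1 [f2 [H1 [H2 Hd]]]]].
  split; [exact Hc|].
  exists f1, f2; split; [exact H1 | split; [exact H2|]].
  intros x y Hxy; destruct (Hd x y Hxy) as [Hx Hy].
  pose proof (locally_singleton _ _ Hxy) as Hpos; unfold half_plane in Hpos; simpl in Hpos.
  split.
  - apply is_derive_ext with (2 := Hx); intros t; now apply Hfg.
  - apply is_derive_ext_loc with (2 := Hy).
    exists (mkposreal y Hpos); intros t Ht; apply Hfg.
    apply Rabs_def2 in Ht; unfold minus, plus, opp in Ht; simpl in Ht; lra.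
Qed.

Lemma Ck_partials (k : nat) (f : R -> R -> R) :
  Ck (S k) half_plane f ->
  Ck k half_plane (D1 f) /\ Ck k half_plane (D2 f) /\
  forall p m, 0 < m ->
    is_derive (fun s => f s m) p (D1 f p m) /\ is_derive (fun s => f p s) m (D2 f p m).
Proof.
  intros [_ [f1 [f2 [H1 [H2 Hd]]]]].
  assert (E1 : forall p m, 0 < m -> f1 p m = D1 f p m).
  { intros p m Hm; symmetry; apply is_derive_unique, Hd, half_plane_locally, Hm. }
  assert (E2 : forall p m, 0 < m -> f2 p m = D2 f p m).
  { intros p m Hm; symmetry; apply is_derive_unique, Hd, half_plane_locally, Hm. }
  split; [exact (Ck_ext k f1 _ E1 H1) | split; [exact (Ck_ext k f2 _ E2 H2)|]].
  intros p m Hm; rewrite <- E1, <- E2 by exact Hm.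
  apply Hd, half_plane_locally, Hm.
Qed.

Lemma C1_differentiable (f : R -> R -> R) (p m : R) :
  Ck 1 half_plane f -> 0 < m ->
  differentiable_pt_lim f p m (D1 f p m) (D2 f p m).
Proof.
  intros Hf Hm.
  destruct (Ck_partials 0 f Hf) as [H1 [_ Hd]].
  apply filterdiff_differentiable_pt_lim.
  apply (is_derive_filterdiff f p m (D1 f) (D2 f p m)).
  - apply filter_imp with (2 := half_plane_locally p m Hm).
    intros [q n] Hn; exact (proj1 (Hd q n Hn)).
  - now apply Hd.
  - apply continuity_2d_pt_filterlim, (Ck_continuity_2d 0 half_plane); [exact H1|].
    now apply half_plane_locally.
Qed.

Lemma Ck_pred (k : nat) (f : R -> R -> R) :
  Ck (S k) half_plane f -> Ck k half_plane f.
Proof.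
  revert f; induction k as [|k IH]; intros f Hf.
  - split; [apply Hf | exact I].
  - destruct Hf as [Hc [f1 [f2 [H1 [H2 Hd]]]]].
    split; [exact Hc|].
    exists f1, f2; split; [now apply IH | split; [now apply IH | exact Hd]].
Qed.

(** Assumption (E) involves [H_mp] as [D1 (D2 H)], whereas differentiating the
    flux [m * H_p] produces [D2 (D1 H)]. *)
Lemma C2_mixed_partials (f : R -> R -> R) (p m : R) :
  Ck 2 half_plane f -> 0 < m -> D1 (D2 f) p m = D2 (D1 f) p m.
Proof.
  intros Hf Hm.
  destruct (Ck_partials 1 f Hf) as [H1 [H2 Hd]].
  destruct (Ck_partials 0 _ H1) as [_ [H12 Hd1]].
  destruct (Ck_partials 0 _ H2) as [H21 [_ Hd2]].
  pose proof (half_plane_locally p m Hm) as Hloc.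
  apply (Schwarz f p m).
  - apply locally_2d_locally.
    apply filter_imp with (2 := Hloc); intros [q n] Hn.
    unfold half_plane in Hn; simpl in *.
    repeat split; eexists.
    + apply (proj1 (Hd q n Hn)).
    + apply (proj2 (Hd q n Hn)).
    + apply (proj1 (Hd2 q n Hn)).
    + apply (proj2 (Hd1 q n Hn)).
  - exact (Ck_continuity_2d 0 half_plane _ p m H21 Hloc).
  - exact (Ck_continuity_2d 0 half_plane _ p m H12 Hloc).
Qed.

(** Strict Lasry-Lions monotonicity, the only structure of the Hamiltonian that
    the comparison principle sees.  Taking [p1 = p2], it contains the strict
    decrease in the density. *)
Record monotone_hamiltonian (H : R -> R -> R) : Prop := {
  mono_cont : forall p m, 0 < m -> continuity_2d_pt H p m;
  mono_cont_p : forall p m, 0 < m -> continuity_2d_pt (D1 H) p m;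
  mono_strict : forall p1 m1 p2 m2, 0 < m1 -> 0 < m2 -> (p1, m1) <> (p2, m2) ->
    (H p1 m1 - H p2 m2) * (m1 - m2)
      - (p1 - p2) * (m1 * D1 H p1 m1 - m2 * D1 H p2 m2) < 0
}.

Lemma pos_def_form (a b c x y : R) :
  0 < a -> 0 < b -> c ^ 2 < 4 * a * b -> (x, y) <> (0, 0) ->
  0 < a * x ^ 2 + c * (x * y) + b * y ^ 2.
Proof.
  intros Ha Hb Hc Hxy.
  apply Rmult_lt_reg_l with (4 * a); [lra|].
  rewrite Rmult_0_r.
  replace (4 * a * (a * x ^ 2 + c * (x * y) + b * y ^ 2))
    with ((2 * a * x + c * y) ^ 2 + (4 * a * b - c ^ 2) * y ^ 2) by ring.
  pose proof (pow2_ge_0 (2 * a * x + c * y)).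
  destruct (Req_dec y 0) as [-> | Hy].
  - assert (Hx : x <> 0) by (intros ->; now apply Hxy).
    replace (2 * a * x + c * 0) with (2 * a * x) by ring.
    assert (0 < (2 * a * x) ^ 2) by (apply pow2_gt_0; nra); nra.
  - assert (0 < y ^ 2) by now apply pow2_gt_0.
    nra.
Qed.

(** Along the segment joining the two states the tested difference has derivative
    [H_m dm^2 - m H_mp dm dp - m H_pp dp^2].  Assumption (E) makes the discriminant
    of this quadratic form negative. *)
Lemma assumption_H_monotone (C0 gamma : R) (Cbar : R -> R) (H : R -> R -> R) :
  0 < C0 -> assumption_H C0 gamma Cbar H -> assumption_E C0 H ->
  monotone_hamiltonian H.
Proof.
  intros hC0 hH hE.
  assert (HC1 : Ck 1 half_plane H) by (do 3 apply Ck_pred; apply hH).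
  assert (HC2 : Ck 2 half_plane H) by (do 2 apply Ck_pred; apply hH).
  assert (HpC1 : Ck 1 half_plane (D1 H)) by (do 3 apply Ck_pred; apply hH).
  split.
  - intros p m Hm; apply (Ck_continuity_2d 1 half_plane _ _ _ HC1), half_plane_locally, Hm.
  - intros p m Hm; apply (Ck_continuity_2d 1 half_plane _ _ _ HpC1), half_plane_locally, Hm.
  - intros p1 m1 p2 m2 Hm1 Hm2 Hne.
    set (dp := p1 - p2); set (dm := m1 - m2).
    set (P := fun s => p2 + s * dp); set (M := fun s => m2 + s * dm).
    (* The segment stays in the half plane, which is convex. *)
    assert (HM : forall s, 0 <= s <= 1 -> 0 < M s).
    { intros s Hs; unfold M, dm.
      replace (m2 + s * (m1 - m2)) with ((1 - s) * m2 + s * m1) by ring.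
      destruct (Req_dec s 0) as [-> | Hs0]; [lra|].
      assert (0 < s * m1) by (apply Rmult_lt_0_compat; lra).
      assert (0 <= (1 - s) * m2) by (apply Rmult_le_pos; lra); lra. }
    assert (HdP : forall s, derivable_pt_lim P s dp).
    { intros s; apply is_derive_Reals; unfold P; auto_derive; [exact I | ring]. }
    assert (HdM : forall s, derivable_pt_lim M s dm).
    { intros s; apply is_derive_Reals; unfold M; auto_derive; [exact I | ring]. }
    pose (g := fun s => H (P s) (M s) * dm - dp * (M s * D1 H (P s) (M s))).
    pose (dg := fun s => (D1 H (P s) (M s) * dp + D2 H (P s) (M s) * dm) * dm
      - dp * (dm * D1 H (P s) (M s)
              + M s * (D1 (D1 H) (P s) (M s) * dp + D2 (D1 H) (P s) (M s) * dm))).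
    destruct (MVT_cor2 g dg 0 1 Rlt_0_1) as [c [Hc Hc01]].
    + intros s Hs; unfold g, dg.
      pose proof (derivable_pt_lim_comp_2d H P M s _ _ _ _
        (C1_differentiable H (P s) (M s) HC1 (HM s Hs)) (HdP s) (HdM s)) as DH.
      pose proof (derivable_pt_lim_comp_2d (D1 H) P M s _ _ _ _
        (C1_differentiable (D1 H) (P s) (M s) HpC1 (HM s Hs)) (HdP s) (HdM s)) as DHp.
      apply (derivable_pt_lim_minus (fun s => H (P s) (M s) * dm)
              (fun s => dp * (M s * D1 H (P s) (M s)))).
      * pose proof (derivable_pt_lim_mult _ (fun _ => dm) s _ 0 DH
          (derivable_pt_lim_const dm s)) as DD.
        unfold mult_fct in DD; rewrite Rmult_0_r, Rplus_0_r in DD; exact DD.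
      * apply (derivable_pt_lim_scal (fun s => M s * D1 H (P s) (M s))).
        exact (derivable_pt_lim_mult M (fun s => D1 H (P s) (M s)) s _ _ (HdM s) DHp).
    + replace ((H p1 m1 - H p2 m2) * dm - dp * (m1 * D1 H p1 m1 - m2 * D1 H p2 m2))
        with (g 1 - g 0).
      2:{ unfold g, P, M.
          replace (p2 + 1 * dp) with p1 by (unfold dp; ring).
          replace (m2 + 1 * dm) with m1 by (unfold dm; ring).
          rewrite !Rmult_0_l, !Rplus_0_r; ring. }
      rewrite Hc, Rminus_0_r, Rmult_1_r; unfold dg; clear Hc.
      assert (Hpos : 0 < M c) by (apply HM; lra).
      rewrite <- (C2_mixed_partials H (P c) (M c) HC2 Hpos).
      pose proof (Hm_neg _ _ _ _ hH (P c) (M c) Hpos) as Hneg.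
      pose proof (Hpp_lower _ _ _ _ hH (P c) (M c) Hpos) as Hpp.
      pose proof (hE (P c) (M c) Hpos) as HE.
      assert (Hpp0 : 0 < D1 (D1 H) (P c) (M c)).
      { apply Rlt_le_trans with (2 := Hpp), Rmult_lt_0_compat.
        - now apply Rinv_0_lt_compat.
        - apply exp_pos. }
      assert (Hv : (dm, dp) <> (0, 0)).
      { intros Hv; injection Hv; intros Hdp Hdm; apply Hne.
        unfold dp, dm in *; f_equal; lra. }
      set (a := - D2 H (P c) (M c)) in *.
      set (b := M c * D1 (D1 H) (P c) (M c)).
      set (e := M c * D1 (D2 H) (P c) (M c)).
      assert (Ha : 0 < a) by (unfold a; lra).
      assert (Hb : 0 < b) by (now apply Rmult_lt_0_compat).
      assert (Hdisc : e ^ 2 < 4 * a * b).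
      { assert (Hi : 0 < / C0) by now apply Rinv_0_lt_compat.
        assert (Hab : 0 < a * b) by now apply Rmult_lt_0_compat.
        assert (HE' : 4 * a * b >= (1 + / C0) * e ^ 2) by (unfold a, b, e; nra).
        (* When the mixed derivative vanishes, strictness comes from [a * b > 0]
           and not from the factor [1 + / C0]. *)
        destruct (Req_dec e 0) as [-> | He]; [simpl; lra|].
        assert (0 < e ^ 2) by now apply pow2_gt_0.
        assert (0 < / C0 * e ^ 2) by now apply Rmult_lt_0_compat.
        lra. }
      pose proof (pos_def_form a b e dm dp Ha Hb Hdisc Hv) as HQ.
      unfold a, b, e in HQ; lra.
Qed.

Lemma mono_decreasing (H : R -> R -> R) (p m1 m2 : R) :
  monotone_hamiltonian H -> 0 < m1 -> m1 <= m2 -> H p m2 <= H p m1.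
Proof.
  intros HH H1 H12.
  destruct (Req_dec m1 m2) as [-> | Hne]; [lra|].
  assert (Hd : (p, m1) <> (p, m2)) by (intros Hq; injection Hq; auto).
  pose proof (mono_strict H HH p m1 p m2 H1 ltac:(lra) Hd); nra.
Qed.
(** * Comparison principle *)

(** The pair [(u, m)] solves the system for times in the open interval [(0, T)],
    with [p] the space derivative of [u] and [r] the time derivative of [m].
    Carrying [p] and [r] as functions keeps the class stable under translations
    and lets constant states be members.  Continuity, periodicity and positivity
    are required at all times, which makes the endpoints [0] and [T] ordinary
    points; a solution on the closed cylinder is extended by freezing time. *)
Record mfg_solution (T : R) (H u m p r : R -> R -> R) : Prop := {
  mfg_cont_u : forall x t, continuity_2d_pt u x t;
  mfg_cont_m : forall x t, continuity_2d_pt m x t;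
  mfg_per_u : forall t, periodic1 (fun x => u x t);
  mfg_per_m : forall t, periodic1 (fun x => m x t);
  mfg_pos : forall x t, 0 < m x t;
  mfg_cont_p : forall x t, 0 < t < T -> continuity_2d_pt p x t;
  mfg_cont_r : forall x t, 0 < t < T -> continuity_2d_pt r x t;
  mfg_ux : forall x t, 0 < t < T -> is_derive (fun y => u y t) x (p x t);
  mfg_HJ : forall x t, 0 < t < T -> is_derive (fun s => u x s) t (H (p x t) (m x t));
  mfg_mt : forall x t, 0 < t < T -> is_derive (fun s => m x s) t (r x t);
  mfg_FP : forall x t, 0 < t < T ->
    is_derive (fun y => m y t * D1 H (p y t) (m y t)) x (r x t)
}.

Lemma continuous_space (f : R -> R -> R) (x t : R) :
  continuity_2d_pt f x t -> continuous (fun y => f y t) x.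
Proof.
  intros Hf; apply (continuity_2d_pt_path f (fun y => y) (fun _ => t));
    [exact Hf | apply continuous_id | apply continuous_const].
Qed.

Lemma continuous_time (f : R -> R -> R) (x t : R) :
  continuity_2d_pt f x t -> continuous (fun s => f x s) t.
Proof.
  intros Hf; apply (continuity_2d_pt_path f (fun _ => x) (fun s => s));
    [exact Hf | apply continuous_const | apply continuous_id].
Qed.

Lemma mfg_per_p (T : R) (H u m p r : R -> R -> R) (t x : R) :
  mfg_solution T H u m p r -> 0 < t < T -> p (x + 1) t = p x t.
Proof.
  intros S Ht.
  rewrite <- (is_derive_unique _ _ _ (mfg_ux _ _ _ _ _ _ S x t Ht)).
  symmetry; apply is_derive_unique.
  apply is_derive_ext with (fun y => u (y + 1) t).
  - intros y; apply (mfg_per_u _ _ _ _ _ _ S t).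
  - apply (is_derive_shift (fun y => u y t)), (mfg_ux _ _ _ _ _ _ S), Ht.
Qed.

Lemma pair_eq_dec (a b c d : R) : (a, b) = (c, d) \/ (a, b) <> (c, d).
Proof.
  destruct (Req_dec a c) as [-> | Ha].
  - destruct (Req_dec b d) as [-> | Hb]; [now left | right; congruence].
  - right; congruence.
Qed.

Lemma is_derive_pos_sq_comp (f : R -> R) (x l : R) :
  is_derive f x l ->
  is_derive (fun y => pos_sq (f y)) x (2 * Rmax (f x) 0 * l).
Proof.
  intros Hf; rewrite Rmult_comm.
  exact (is_derive_comp pos_sq f x _ _ (is_derive_pos_sq (f x)) Hf).
Qed.

Section Comparison.

Variables (T : R) (H : R -> R -> R).
Hypothesis HT : 0 < T.
Hypothesis Hmono : monotone_hamiltonian H.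
Variables (u1 m1 p1 r1 u2 m2 p2 r2 : R -> R -> R).
Hypothesis S1 : mfg_solution T H u1 m1 p1 r1.
Hypothesis S2 : mfg_solution T H u2 m2 p2 r2.
Variable k : R.

Let w x t := u1 x t - u2 x t - k.
Let flux (m p : R -> R -> R) x t := m x t * D1 H (p x t) (m x t).
Let dflux x t := flux m1 p1 x t - flux m2 p2 x t.
Let dham x t := H (p1 x t) (m1 x t) - H (p2 x t) (m2 x t).

Let weight x t := 2 * Rmax (w x t) 0.
Let dissipation x t :=
  weight x t * (dham x t * (m1 x t - m2 x t) - (p1 x t - p2 x t) * dflux x t).
Let dx_flux x t :=
  weight x t * (p1 x t - p2 x t) * dflux x t + pos_sq (w x t) * (r1 x t - r2 x t).
Let energy a t := RInt (fun x => pos_sq (w x t) * (m1 x t - m2 x t)) a (a + 1).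

Lemma comparison_w_cont x t : continuity_2d_pt w x t.
Proof.
  apply (continuity_2d_pt_minus (fun x t => u1 x t - u2 x t) (fun _ _ => k)).
  - apply continuity_2d_pt_minus; [apply (mfg_cont_u _ _ _ _ _ _ S1) | apply (mfg_cont_u _ _ _ _ _ _ S2)].
  - apply continuity_2d_pt_const.
Qed.

Lemma comparison_sq_cont x t : continuity_2d_pt (fun x t => pos_sq (w x t)) x t.
Proof.
  apply (continuity_1d_2d_pt_comp pos_sq w).
  - apply continuity_pt_filterlim, continuous_pos_sq.
  - apply comparison_w_cont.
Qed.

Lemma comparison_weight_cont x t : continuity_2d_pt weight x t.
Proof.
  apply (continuity_1d_2d_pt_comp (fun z => 2 * Rmax z 0) w).
  - apply continuity_pos_part.
  - apply comparison_w_cont.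
Qed.

Lemma comparison_flux_cont u m p r x t :
  mfg_solution T H u m p r -> 0 < t < T -> continuity_2d_pt (flux m p) x t.
Proof.
  intros S Ht; apply continuity_2d_pt_mult; [apply (mfg_cont_m _ _ _ _ _ _ S)|].
  apply continuity_2d_pt_comp_2.
  - apply (mono_cont_p _ Hmono), (mfg_pos _ _ _ _ _ _ S).
  - now apply (mfg_cont_p _ _ _ _ _ _ S).
  - apply (mfg_cont_m _ _ _ _ _ _ S).
Qed.

Lemma comparison_ham_cont u m p r x t :
  mfg_solution T H u m p r -> 0 < t < T ->
  continuity_2d_pt (fun x t => H (p x t) (m x t)) x t.
Proof.
  intros S Ht; apply continuity_2d_pt_comp_2.
  - apply (mono_cont _ Hmono), (mfg_pos _ _ _ _ _ _ S).
  - now apply (mfg_cont_p _ _ _ _ _ _ S).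
  - apply (mfg_cont_m _ _ _ _ _ _ S).
Qed.

Lemma comparison_dp_cont x t :
  0 < t < T -> continuity_2d_pt (fun x t => p1 x t - p2 x t) x t.
Proof.
  intros Ht; apply continuity_2d_pt_minus;
    [apply (mfg_cont_p _ _ _ _ _ _ S1) | apply (mfg_cont_p _ _ _ _ _ _ S2)]; exact Ht.
Qed.

Lemma comparison_dm_cont x t : continuity_2d_pt (fun x t => m1 x t - m2 x t) x t.
Proof.
  apply continuity_2d_pt_minus;
    [apply (mfg_cont_m _ _ _ _ _ _ S1) | apply (mfg_cont_m _ _ _ _ _ _ S2)].
Qed.

Lemma comparison_dflux_cont x t : 0 < t < T -> continuity_2d_pt dflux x t.
Proof.
  intros Ht; apply continuity_2d_pt_minus; eapply comparison_flux_cont; eauto.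
Qed.

Lemma comparison_dissipation_cont x t : 0 < t < T -> continuity_2d_pt dissipation x t.
Proof.
  intros Ht; apply continuity_2d_pt_mult; [apply comparison_weight_cont|].
  apply (continuity_2d_pt_minus (fun x t => dham x t * (m1 x t - m2 x t))
           (fun x t => (p1 x t - p2 x t) * dflux x t)).
  - apply (continuity_2d_pt_mult dham (fun x t => m1 x t - m2 x t)).
    + apply continuity_2d_pt_minus; eapply comparison_ham_cont; eauto.
    + apply comparison_dm_cont.
  - apply (continuity_2d_pt_mult (fun x t => p1 x t - p2 x t) dflux).
    + now apply comparison_dp_cont.
    + now apply comparison_dflux_cont.
Qed.

Lemma comparison_dx_flux_cont x t : 0 < t < T -> continuity_2d_pt dx_flux x t.
Proof.
  intros Ht.
  apply (continuity_2d_pt_plus (fun x t => weight x t * (p1 x t - p2 x t) * dflux x t)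
          (fun x t => pos_sq (w x t) * (r1 x t - r2 x t))).
  - apply (continuity_2d_pt_mult (fun x t => weight x t * (p1 x t - p2 x t)) dflux).
    + apply (continuity_2d_pt_mult weight (fun x t => p1 x t - p2 x t)).
      * apply comparison_weight_cont.
      * now apply comparison_dp_cont.
    + now apply comparison_dflux_cont.
  - apply (continuity_2d_pt_mult (fun x t => pos_sq (w x t)) (fun x t => r1 x t - r2 x t)).
    + apply comparison_sq_cont.
    + apply continuity_2d_pt_minus;
        [apply (mfg_cont_r _ _ _ _ _ _ S1) | apply (mfg_cont_r _ _ _ _ _ _ S2)]; exact Ht.
Qed.

Lemma comparison_wx x t :
  0 < t < T -> is_derive (fun y => w y t) x (p1 x t - p2 x t).
Proof.
  intros Ht; replace (p1 x t - p2 x t) with (p1 x t - p2 x t - 0) by ring.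
  apply (is_derive_Rminus (fun y => u1 y t - u2 y t) (fun _ => k)).
  - apply is_derive_Rminus; [apply (mfg_ux _ _ _ _ _ _ S1) | apply (mfg_ux _ _ _ _ _ _ S2)]; exact Ht.
  - apply (is_derive_const (V := R_NormedModule)).
Qed.

Lemma comparison_wt x t :
  0 < t < T -> is_derive (fun s => w x s) t (dham x t).
Proof.
  intros Ht; replace (dham x t) with (dham x t - 0) by ring.
  apply (is_derive_Rminus (fun s => u1 x s - u2 x s) (fun _ => k)).
  - apply is_derive_Rminus; [apply (mfg_HJ _ _ _ _ _ _ S1) | apply (mfg_HJ _ _ _ _ _ _ S2)]; exact Ht.
  - apply (is_derive_const (V := R_NormedModule)).
Qed.

(** The integrand is the space derivative of the periodic function
    [(w^+)^2 * (m1 H_p1 - m2 H_p2)]. *)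
Lemma comparison_flux_mean a t : 0 < t < T -> RInt (fun x => dx_flux x t) a (a + 1) = 0.
Proof.
  intros Ht; apply is_RInt_unique.
  pose (J := fun x => pos_sq (w x t) * dflux x t).
  replace 0 with (minus (J (a + 1)) (J a)).
  - apply (is_RInt_derive J); intros x _.
    + unfold J, dx_flux.
      apply (is_derive_Rmult (fun y => pos_sq (w y t)) (fun y => dflux y t)).
      * apply (is_derive_pos_sq_comp (fun y => w y t)), comparison_wx, Ht.
      * apply is_derive_Rminus; [apply (mfg_FP _ _ _ _ _ _ S1) | apply (mfg_FP _ _ _ _ _ _ S2)]; exact Ht.
    + apply continuous_space, comparison_dx_flux_cont, Ht.
  - unfold J, dflux, flux, w.
    rewrite (mfg_per_p _ _ _ _ _ _ t a S1 Ht), (mfg_per_p _ _ _ _ _ _ t a S2 Ht).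
    rewrite (mfg_per_u _ _ _ _ _ _ S1 t a), (mfg_per_u _ _ _ _ _ _ S2 t a).
    rewrite (mfg_per_m _ _ _ _ _ _ S1 t a), (mfg_per_m _ _ _ _ _ _ S2 t a).
    unfold minus, plus, opp; simpl; ring.
Qed.

(** The transport equation turns the time derivative of the energy into the
    dissipation plus an exact space derivative, whose mean over a period vanishes. *)
Lemma comparison_energy_derive a t :
  0 < t < T ->
  is_derive (energy a) t (RInt (fun x => dissipation x t) a (a + 1)).
Proof.
  intros Ht.
  replace (RInt (fun x => dissipation x t) a (a + 1))
    with (RInt (fun x => dissipation x t + dx_flux x t) a (a + 1)).
  2:{ rewrite <- (Rplus_0_r (RInt (fun x => dissipation x t) _ _)).
      rewrite <- (comparison_flux_mean a t Ht).
      apply (RInt_plus (V := R_CompleteNormedModule));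
        apply ex_RInt_cont; intros x; apply continuous_space.
      - now apply comparison_dissipation_cont.
      - now apply comparison_dx_flux_cont. }
  assert (Hd : 0 < Rmin t (T - t)) by (apply Rmin_pos; lra).
  apply (is_derive_RInt_second (fun x t => pos_sq (w x t) * (m1 x t - m2 x t))
           (fun x t => dissipation x t + dx_flux x t) _ _ _ (mkposreal _ Hd)).
  - simpl; intros x s Hs; apply Rabs_def2 in Hs.
    pose proof (Rmin_l t (T - t)); pose proof (Rmin_r t (T - t)).
    assert (Hs' : 0 < s < T) by lra.
    replace (dissipation x s + dx_flux x s)
      with (weight x s * dham x s * (m1 x s - m2 x s) + pos_sq (w x s) * (r1 x s - r2 x s))
      by (unfold dissipation, dx_flux; ring).
    apply (is_derive_Rmult (fun s => pos_sq (w x s)) (fun s => m1 x s - m2 x s)).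
    + apply (is_derive_pos_sq_comp (fun s => w x s)), comparison_wt, Hs'.
    + apply is_derive_Rminus; [apply (mfg_mt _ _ _ _ _ _ S1) | apply (mfg_mt _ _ _ _ _ _ S2)]; exact Hs'.
  - intros x; apply continuity_2d_pt_plus.
    + now apply comparison_dissipation_cont.
    + now apply comparison_dx_flux_cont.
  - intros x s; apply (continuity_2d_pt_mult (fun x t => pos_sq (w x t)) (fun x t => m1 x t - m2 x t)).
    + apply comparison_sq_cont.
    + apply comparison_dm_cont.
Qed.

Lemma comparison_energy_cont a t : continuous (energy a) t.
Proof.
  apply (continuous_RInt_param (fun x t => pos_sq (w x t) * (m1 x t - m2 x t))); [lra|].
  intros x s; apply (continuity_2d_pt_mult (fun x t => pos_sq (w x t)) (fun x t => m1 x t - m2 x t)).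
  - apply comparison_sq_cont.
  - apply comparison_dm_cont.
Qed.

Lemma comparison_weight_ge0 x t : 0 <= weight x t.
Proof. unfold weight; pose proof (Rmax_r (w x t) 0); lra. Qed.

Lemma comparison_dissipation_nonpos x t : dissipation x t <= 0.
Proof.
  pose proof (comparison_weight_ge0 x t) as Hw.
  unfold dissipation.
  destruct (pair_eq_dec (p1 x t) (m1 x t) (p2 x t) (m2 x t)) as [Heq | Hne].
  - injection Heq; intros Em Ep; unfold dham, dflux, flux; rewrite Em, Ep; lra.
  - pose proof (mono_strict _ Hmono _ _ _ _ (mfg_pos _ _ _ _ _ _ S1 x t)
      (mfg_pos _ _ _ _ _ _ S2 x t) Hne) as Hs.
    unfold dham, dflux, flux; nra.
Qed.

Hypothesis Hinit : forall x, u1 x 0 - u2 x 0 <= k \/ m1 x 0 <= m2 x 0.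
Hypothesis Hterm : forall x, u1 x T - u2 x T <= k \/ m2 x T <= m1 x T.

Lemma comparison_energy_init a : energy a 0 <= 0.
Proof.
  replace 0 with (RInt (fun _ => 0) a (a + 1)) at 2
    by (rewrite RInt_const; unfold scal; simpl; unfold mult; simpl; ring).
  apply RInt_le; [lra | | |].
  - apply ex_RInt_cont; intros x.
    apply (continuous_space (fun x t => pos_sq (w x t) * (m1 x t - m2 x t))).
    apply (continuity_2d_pt_mult (fun x t => pos_sq (w x t)) (fun x t => m1 x t - m2 x t));
      [apply comparison_sq_cont | apply comparison_dm_cont].
  - apply ex_RInt_cont; intros; apply continuous_const.
  - intros x _; pose proof (pos_sq_ge0 (w x 0)).
    destruct (Hinit x) as [Hw | Hm]; [rewrite pos_sq_nonpos by (unfold w; lra); lra | nra].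
Qed.

Lemma comparison_energy_term a : 0 <= energy a T.
Proof.
  replace 0 with (RInt (fun _ => 0) a (a + 1))
    by (rewrite RInt_const; unfold scal; simpl; unfold mult; simpl; ring).
  apply RInt_le; [lra | | |].
  - apply ex_RInt_cont; intros; apply continuous_const.
  - apply ex_RInt_cont; intros x.
    apply (continuous_space (fun x t => pos_sq (w x t) * (m1 x t - m2 x t))).
    apply (continuity_2d_pt_mult (fun x t => pos_sq (w x t)) (fun x t => m1 x t - m2 x t));
      [apply comparison_sq_cont | apply comparison_dm_cont].
  - intros x _; pose proof (pos_sq_ge0 (w x T)).
    destruct (Hterm x) as [Hw | Hm]; [rewrite pos_sq_nonpos by (unfold w; lra); lra | nra].
Qed.

Lemma comparison_dissipation_mean_nonpos a t :
  0 < t < T -> RInt (fun x => dissipation x t) a (a + 1) <= 0.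
Proof.
  intros Ht.
  replace 0 with (RInt (fun _ => 0) a (a + 1))
    by (rewrite RInt_const; unfold scal; simpl; unfold mult; simpl; ring).
  apply RInt_le; [lra | | |].
  - apply ex_RInt_cont; intros x; apply continuous_space, comparison_dissipation_cont, Ht.
  - apply ex_RInt_cont; intros; apply continuous_const.
  - intros x _; apply comparison_dissipation_nonpos.
Qed.

Lemma comparison_energy_zero a t : 0 <= t <= T -> energy a t = 0.
Proof.
  intros Ht.
  assert (Hdec : forall s s', 0 <= s -> s <= s' -> s' <= T -> energy a s' <= energy a s).
  { intros s s' H0 H1 H2.
    apply (nonincreasing_interior (energy a)
             (fun t => RInt (fun x => dissipation x t) a (a + 1))); [exact H1 | | |].
    - intros x _; apply comparison_energy_cont.
    - intros x Hx; apply comparison_energy_derive; lra.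
    - intros x Hx; apply comparison_dissipation_mean_nonpos; lra. }
  pose proof (Hdec 0 t ltac:(lra) ltac:(lra) ltac:(lra)).
  pose proof (Hdec t T ltac:(lra) ltac:(lra) ltac:(lra)).
  pose proof (comparison_energy_init a); pose proof (comparison_energy_term a); lra.
Qed.

(** The energy is nonincreasing, nonpositive initially and nonnegative finally,
    so it is identically zero and its derivative, the mean of a nonpositive
    quantity, is zero.  The period is centred at the given point to make that
    point interior. *)
Lemma comparison_dissipation_zero x t : 0 < t < T -> dissipation x t = 0.
Proof.
  intros Ht.
  set (a := x - / 2).
  apply (RInt_zero_nonpos (fun y => dissipation y t) a (a + 1)).
  - unfold a; lra.
  - intros y; apply continuous_space, comparison_dissipation_cont, Ht.
  - intros y; apply comparison_dissipation_nonpos.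
  - rewrite <- (is_derive_unique _ _ _ (comparison_energy_derive a t Ht)).
    apply is_derive_unique.
    apply is_derive_ext_loc with (fun _ => 0); [|apply (is_derive_const (V := R_NormedModule))].
    assert (Hd : 0 < Rmin t (T - t)) by (apply Rmin_pos; lra).
    exists (mkposreal _ Hd); intros s Hs; simpl in Hs.
    apply Rabs_def2 in Hs; unfold minus, plus, opp in Hs; simpl in Hs.
    pose proof (Rmin_l t (T - t)); pose proof (Rmin_r t (T - t)).
    symmetry; apply comparison_energy_zero; lra.
Qed.

(** Strict monotonicity: where the truncated difference is active, both states
    have the same gradient and density, so the difference does not vary there. *)
Lemma comparison_locked x t :
  0 < t < T -> weight x t * (p1 x t - p2 x t) = 0 /\ weight x t * dham x t = 0.
Proof.
  intros Ht.
  pose proof (comparison_dissipation_zero x t Ht) as Hz.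
  pose proof (comparison_weight_ge0 x t) as Hw.
  destruct (pair_eq_dec (p1 x t) (m1 x t) (p2 x t) (m2 x t)) as [Heq | Hne].
  - injection Heq; intros Em Ep; unfold dham; rewrite Em, Ep; split; ring.
  - pose proof (mono_strict _ Hmono _ _ _ _ (mfg_pos _ _ _ _ _ _ S1 x t)
      (mfg_pos _ _ _ _ _ _ S2 x t) Hne) as Hs.
    unfold dissipation, dham, dflux, flux in Hz.
    apply Rmult_integral in Hz; destruct Hz as [-> | Hz]; [split; ring | lra].
Qed.

Lemma comparison_constant x t y s :
  0 <= t <= T -> 0 <= s <= T -> pos_sq (w x t) = pos_sq (w y s).
Proof.
  intros Ht Hs.
  assert (Htime : forall z a b, 0 <= a -> a <= b -> b <= T ->
            pos_sq (w z a) = pos_sq (w z b)).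
  { intros z a b Ha Hab Hb.
    apply (constant_interior (fun c => pos_sq (w z c)) a b Hab).
    - intros c _; apply (continuous_time (fun x t => pos_sq (w x t))), comparison_sq_cont.
    - intros c Hc; rewrite <- (proj2 (comparison_locked z c ltac:(lra))).
      apply (is_derive_pos_sq_comp (fun s => w z s)), comparison_wt; lra. }
  assert (Hspace : forall a b, a <= b -> pos_sq (w a (T / 2)) = pos_sq (w b (T / 2))).
  { intros a b Hab.
    apply (constant_interior (fun c => pos_sq (w c (T / 2))) a b Hab).
    - intros c _; apply (continuous_space (fun x t => pos_sq (w x t))), comparison_sq_cont.
    - intros c _; rewrite <- (proj1 (comparison_locked c (T / 2) ltac:(lra))).
      apply (is_derive_pos_sq_comp (fun s => w s (T / 2))), comparison_wx; lra. }
  assert (Hmid : forall z a, 0 <= a <= T -> pos_sq (w z a) = pos_sq (w z (T / 2))).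
  { intros z a Ha; destruct (Rle_dec a (T / 2)); [|symmetry]; apply Htime; lra. }
  rewrite (Hmid x t Ht), (Hmid y s Hs).
  destruct (Rle_dec x y); [|symmetry]; apply Hspace; lra.
Qed.

(** Since the truncated difference is constant over the whole strip, one point
    where it vanishes suffices. *)
Lemma comparison_principle y s :
  0 <= s <= T -> u1 y s - u2 y s <= k ->
  forall x t, 0 <= t <= T -> u1 x t - u2 x t <= k.
Proof.
  intros Hs Hle x t Ht.
  pose proof (comparison_constant x t y s Ht Hs) as Hc.
  rewrite (pos_sq_nonpos (w y s)) in Hc by (unfold w; lra).
  apply pos_sq_eq0 in Hc; unfold w in Hc; lra.
Qed.

End Comparison.
(** * Instances of the solution class *)

Lemma continuity_2d_pt_shift (f : R -> R -> R) (a h x t : R) :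
  continuity_2d_pt f (x + a) (t + h) ->
  continuity_2d_pt (fun y s => f (y + a) (s + h)) x t.
Proof.
  intros Hf e; destruct (Hf e) as [d Hd]; exists d; intros y s Hy Hs.
  apply Hd; [replace (y + a - (x + a)) with (y - x) by ring
            | replace (s + h - (t + h)) with (s - t) by ring]; assumption.
Qed.

Lemma mfg_shift (T : R) (H u m p r : R -> R -> R) (a h : R) :
  0 <= h -> mfg_solution T H u m p r ->
  mfg_solution (T - h) H
    (fun x t => u (x + a) (t + h)) (fun x t => m (x + a) (t + h))
    (fun x t => p (x + a) (t + h)) (fun x t => r (x + a) (t + h)).
Proof.
  intros Hh S; split.
  - intros x t; apply continuity_2d_pt_shift, (mfg_cont_u _ _ _ _ _ _ S).
  - intros x t; apply continuity_2d_pt_shift, (mfg_cont_m _ _ _ _ _ _ S).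
  - intros t x; replace (x + 1 + a) with (x + a + 1) by ring.
    apply (mfg_per_u _ _ _ _ _ _ S).
  - intros t x; replace (x + 1 + a) with (x + a + 1) by ring.
    apply (mfg_per_m _ _ _ _ _ _ S).
  - intros x t; apply (mfg_pos _ _ _ _ _ _ S).
  - intros x t Ht; apply continuity_2d_pt_shift, (mfg_cont_p _ _ _ _ _ _ S); lra.
  - intros x t Ht; apply continuity_2d_pt_shift, (mfg_cont_r _ _ _ _ _ _ S); lra.
  - intros x t Ht; apply (is_derive_shift (fun y => u y (t + h))), (mfg_ux _ _ _ _ _ _ S); lra.
  - intros x t Ht; apply (is_derive_shift (fun s => u (x + a) s)), (mfg_HJ _ _ _ _ _ _ S); lra.
  - intros x t Ht; apply (is_derive_shift (fun s => m (x + a) s)), (mfg_mt _ _ _ _ _ _ S); lra.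
  - intros x t Ht.
    apply (is_derive_shift (fun y => m y (t + h) * D1 H (p y (t + h)) (m y (t + h)))),
      (mfg_FP _ _ _ _ _ _ S); lra.
Qed.

Lemma mfg_constant_state (T : R) (H : R -> R -> R) (mu c : R) :
  0 < mu ->
  mfg_solution T H (fun _ t => H 0 mu * (t - c)) (fun _ _ => mu)
    (fun _ _ => 0) (fun _ _ => 0).
Proof.
  intros Hmu; split; try (intros; apply continuity_2d_pt_const).
  - intros x t; apply continuity_2d_pt_mult; [apply continuity_2d_pt_const|].
    apply continuity_2d_pt_minus; [apply continuity_2d_pt_id2 | apply continuity_2d_pt_const].
  - intros t x; reflexivity.
  - intros t x; reflexivity.
  - intros _ _; exact Hmu.
  - intros x t _; apply (is_derive_const (V := R_NormedModule)).
  - intros x t _; auto_derive; [exact I | ring].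
  - intros x t _; apply (is_derive_const (V := R_NormedModule)).
  - intros x t _; apply (is_derive_const (V := R_NormedModule)).
Qed.

(** Freezing time outside [[0, T]] turns continuity on the closed strip into
    continuity on the whole plane. *)
Definition clamp (T t : R) : R := Rmax 0 (Rmin t T).

Lemma clamp_range (T t : R) : 0 < T -> 0 <= clamp T t <= T.
Proof.
  intros HT; unfold clamp, Rmax, Rmin.
  destruct (Rle_dec t T); destruct (Rle_dec 0 _); lra.
Qed.

Lemma clamp_id (T t : R) : 0 <= t <= T -> clamp T t = t.
Proof. intros Ht; unfold clamp; rewrite Rmin_left, Rmax_right; lra. Qed.

Lemma clamp_lipschitz (T s t : R) : Rabs (clamp T s - clamp T t) <= Rabs (s - t).
Proof.
  unfold clamp; apply Rle_trans with (Rabs (Rmin s T - Rmin t T)).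
  - generalize (Rmin s T) (Rmin t T); intros a b; unfold Rmax, Rabs.
    destruct (Rle_dec 0 a), (Rle_dec 0 b); repeat destruct Rcase_abs; lra.
  - unfold Rmin, Rabs.
    destruct (Rle_dec s T), (Rle_dec t T); repeat destruct Rcase_abs; lra.
Qed.

Lemma continuity_2d_pt_clamp (T : R) (f : R -> R -> R) (x t : R) :
  0 < T -> continuous_on (closed_strip T) (fun z => f (fst z) (snd z)) ->
  continuity_2d_pt (fun y s => f y (clamp T s)) x t.
Proof.
  intros HT Hf e.
  pose proof (proj1 (filterlim_locally _ _) (Hf (x, clamp T t) (clamp_range T t HT)) e) as He.
  unfold within in He.
  destruct He as [d Hd].
  exists d; intros y s Hy Hs.
  apply (Hd (y, clamp T s)).
  - split; [exact Hy|].
    exact (Rle_lt_trans _ _ _ (clamp_lipschitz T s t) Hs).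
  - apply clamp_range, HT.
Qed.

Lemma strip_locally (T x t : R) : 0 < t < T -> locally (x, t) (closed_strip T).
Proof.
  intros Ht.
  assert (Hp : 0 < Rmin t (T - t)) by (apply Rmin_pos; lra).
  exists (mkposreal _ Hp); intros [y s] [_ Hs]; simpl in Hs.
  apply Rabs_def2 in Hs; unfold minus, plus, opp in Hs; simpl in Hs.
  pose proof (Rmin_l t (T - t)); pose proof (Rmin_r t (T - t)).
  unfold closed_strip; simpl; lra.
Qed.

Lemma is_derive_clamp (T : R) (f : R -> R) (t l : R) :
  0 < t < T -> is_derive f t l -> is_derive (fun s => f (clamp T s)) t l.
Proof.
  intros Ht; apply is_derive_ext_loc.
  assert (Hp : 0 < Rmin t (T - t)) by (apply Rmin_pos; lra).
  exists (mkposreal _ Hp); intros s Hs; simpl in Hs.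
  apply Rabs_def2 in Hs; unfold minus, plus, opp in Hs; simpl in Hs.
  pose proof (Rmin_l t (T - t)); pose proof (Rmin_r t (T - t)).
  rewrite clamp_id by lra; reflexivity.
Qed.

Lemma classical_mfg_solution (T : R) (H : R -> R -> R) (m0 mT : R -> R) (eps : R)
    (u m : R -> R -> R) :
  0 < T -> Ck 1 half_plane (D1 H) -> classical_solution T H m0 mT eps u m ->
  exists p r, mfg_solution T H (fun x t => u x (clamp T t)) (fun x t => m x (clamp T t)) p r.
Proof.
  intros HT HpC1 S.
  destruct (sol_u_C2 _ _ _ _ _ _ _ S) as [Hcu [p [q [Hp [Hq Hdu]]]]].
  destruct (sol_m_C1 _ _ _ _ _ _ _ S) as [Hcm [mx [r [Hmx [Hr Hdm]]]]].
  assert (Ep : forall x t, 0 < t < T -> D1 u x t = p x t).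
  { intros x t Ht; apply is_derive_unique, Hdu, strip_locally, Ht. }
  assert (Eq : forall x t, 0 < t < T -> D2 u x t = q x t).
  { intros x t Ht; apply is_derive_unique, Hdu, strip_locally, Ht. }
  assert (Er : forall x t, 0 < t < T -> D2 m x t = r x t).
  { intros x t Ht; apply is_derive_unique, Hdm, strip_locally, Ht. }
  exists p, r; split.
  - intros x t; now apply (continuity_2d_pt_clamp T u).
  - intros x t; now apply (continuity_2d_pt_clamp T m).
  - intros t; apply (sol_u_per _ _ _ _ _ _ _ S), clamp_range, HT.
  - intros t; apply (sol_m_per _ _ _ _ _ _ _ S), clamp_range, HT.
  - intros x t; apply (sol_m_pos _ _ _ _ _ _ _ S), clamp_range, HT.
  - intros x t Ht; apply (Ck_continuity_2d 1 _ _ _ _ Hp), strip_locally, Ht.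
  - intros x t Ht; apply (Ck_continuity_2d 0 _ _ _ _ Hr), strip_locally, Ht.
  - intros x t Ht; rewrite clamp_id by lra; apply Hdu, strip_locally, Ht.
  - intros x t Ht; rewrite clamp_id by lra.
    apply (is_derive_clamp T (fun s => u x s) t _ Ht).
    pose proof (sol_HJ _ _ _ _ _ _ _ S x t Ht) as HJ.
    rewrite Ep, Eq in HJ by exact Ht.
    replace (H (p x t) (m x t)) with (q x t) by lra.
    apply Hdu, strip_locally, Ht.
  - intros x t Ht; apply (is_derive_clamp T (fun s => m x s) t _ Ht).
    apply Hdm, strip_locally, Ht.
  - intros x t Ht; rewrite clamp_id by lra.
    pose proof (sol_FP _ _ _ _ _ _ _ S x t Ht) as HFP.
    rewrite Er in HFP by exact Ht.
    replace (r x t) with (Derive (fun y => m y t * D1 H (p y t) (m y t)) x).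
    2:{ replace (r x t) with (D1 (fun y s => m y s * D1 H (D1 u y s) (m y s)) x t) by lra.
        apply Derive_ext; intros y; now rewrite Ep. }
    apply Derive_correct.
    destruct Hp as [_ [px [pt [_ [_ Hdp]]]]].
    pose proof (proj1 (Hdm x t (strip_locally T x t Ht))) as Dm.
    pose proof (proj1 (Hdp x t (strip_locally T x t Ht))) as Dp.
    assert (Hpos : 0 < m x t) by (apply (sol_m_pos _ _ _ _ _ _ _ S); lra).
    pose proof (derivable_pt_lim_comp_2d (D1 H) (fun y => p y t) (fun y => m y t) x _ _ _ _
      (C1_differentiable _ _ _ HpC1 Hpos)
      (proj1 (is_derive_Reals _ _ _) Dp) (proj1 (is_derive_Reals _ _ _) Dm)) as DF.
    eexists; apply (is_derive_Rmult (fun y => m y t)); [exact Dm|].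
    apply is_derive_Reals, DF.
Qed.

Lemma mfg_mass (T : R) (H u m p r : R -> R -> R) :
  0 < T -> mfg_solution T H u m p r ->
  RInt (fun x => m x 0) 0 1 = RInt (fun x => m x T) 0 1.
Proof.
  intros HT S.
  apply (constant_interior (fun t => RInt (fun x => m x t) 0 1)); [lra | |].
  - intros t _; apply continuous_RInt_param; [lra|]; apply (mfg_cont_m _ _ _ _ _ _ S).
  - intros t Ht.
    assert (Hz : RInt (fun x => r x t) 0 1 = 0).
    { apply is_RInt_unique.
      pose (J := fun x => m x t * D1 H (p x t) (m x t)).
      replace 0 with (minus (J (0 + 1)) (J 0)) at 2.
      - rewrite Rplus_0_l; apply (is_RInt_derive J); intros x _.
        + now apply (mfg_FP _ _ _ _ _ _ S).
        + now apply continuous_space, (mfg_cont_r _ _ _ _ _ _ S).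
      - unfold J; rewrite (mfg_per_p _ _ _ _ _ _ t 0 S Ht), (mfg_per_m _ _ _ _ _ _ S t 0).
        unfold minus, plus, opp; simpl; ring. }
    assert (Hp : 0 < Rmin t (T - t)) by (apply Rmin_pos; lra).
    pose proof (is_derive_RInt_second m r 0 1 t (mkposreal _ Hp)) as HD.
    rewrite Hz in HD; apply HD.
    + simpl; intros x s Hs; apply Rabs_def2 in Hs.
      pose proof (Rmin_l t (T - t)); pose proof (Rmin_r t (T - t)).
      apply (mfg_mt _ _ _ _ _ _ S); lra.
    + intros x; now apply (mfg_cont_r _ _ _ _ _ _ S).
    + apply (mfg_cont_m _ _ _ _ _ _ S).
Qed.

(** * Transport along straight lines *)

(** The slope [f'] grows at least like [c * ln (1 + x)], so it exceeds [V] at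
    some point [P]; the tangent at [P] lies below the convex function [f]. *)
Lemma log_slope_half_line (f f' f'' : R -> R) (c V : R) :
  0 < c ->
  (forall x, is_derive f x (f' x)) -> (forall x, is_derive f' x (f'' x)) ->
  (forall x, c / (1 + Rabs x) <= f'' x) ->
  exists C, forall x v, 0 <= x -> - V <= v -> - C <= f x + v * x.
Proof.
  intros Hc Df Df' Hlow.
  assert (Hlow0 : forall x, 0 <= f'' x).
  { intros x; apply Rle_trans with (2 := Hlow x), Rlt_le, Rdiv_lt_0_compat; [exact Hc|].
    pose proof (Rabs_pos x); lra. }
  assert (Hincr : forall x y, x <= y -> f' x <= f' y).
  { intros x y Hxy; apply Ropp_le_cancel.
    apply (nonincreasing_interior (fun z => - f' z) (fun z => - f'' z)); [exact Hxy | | |].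
    - intros z _; apply (ex_derive_continuous (fun z => - f' z)).
      exists (- f'' z); apply (is_derive_opp f'), Df'.
    - intros z _; apply (is_derive_opp f'), Df'.
    - intros z _; specialize (Hlow0 z); lra. }
  assert (Hlog : forall x, 0 <= x -> f' 0 + c * ln (1 + x) <= f' x).
  { intros x Hx.
    assert (DL : forall z, 0 <= z ->
              is_derive (fun y => c * ln (1 + y) - f' y) z (c / (1 + z) - f'' z)).
    { intros z Hz; apply is_derive_Rminus; [|apply Df'].
      auto_derive; [lra | field; lra]. }
    pose proof (nonincreasing_interior (fun z => c * ln (1 + z) - f' z)
      (fun z => c / (1 + z) - f'' z) 0 x Hx) as Hm.
    cbv beta in Hm; rewrite Rplus_0_r, ln_1 in Hm.
    enough (c * ln (1 + x) - f' x <= c * 0 - f' 0) by lra.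
    apply Hm.
    - intros z Hz; apply (ex_derive_continuous (fun z => c * ln (1 + z) - f' z)).
      eexists; apply DL; lra.
    - intros z Hz; apply DL; lra.
    - intros z Hz; specialize (Hlow z); rewrite Rabs_pos_eq in Hlow by lra; lra. }
  (* [P] is chosen so that the logarithmic lower bound for [f' P] reaches [V]. *)
  set (W := Rmax 0 ((V - f' 0) / c)).
  set (P := exp W - 1).
  assert (HP : 0 <= P).
  { unfold P; pose proof (exp_ineq1_le W); pose proof (Rmax_l 0 ((V - f' 0) / c)).
    fold W in H0; lra. }
  assert (HV : V <= f' P).
  { apply Rle_trans with (2 := Hlog P HP).
    replace (1 + P) with (exp W) by (unfold P; ring); rewrite ln_exp.
    pose proof (Rmax_r 0 ((V - f' 0) / c)) as HW; fold W in HW.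
    apply (Rmult_le_compat_l c) in HW; [|lra].
    replace (c * ((V - f' 0) / c)) with (V - f' 0) in HW by (field; lra); lra. }
  exists (f' P * P - f P); intros x v Hx Hv.
  assert (Htan : f P + f' P * (x - P) <= f x).
  { destruct (Rtotal_order P x) as [HPx | [<- | HPx]]; [|lra|].
    - destruct (MVT_cor2 f f' P x HPx) as [z [Hz Hzz]];
        [intros; apply is_derive_Reals, Df|].
      pose proof (Hincr P z ltac:(lra)); nra.
    - destruct (MVT_cor2 f f' x P HPx) as [z [Hz Hzz]];
        [intros; apply is_derive_Reals, Df|].
      pose proof (Hincr z P ltac:(lra)); nra. }
  nra.
Qed.

Lemma log_slope_coercive (f f' f'' : R -> R) (c V : R) :
  0 < c ->
  (forall x, is_derive f x (f' x)) -> (forall x, is_derive f' x (f'' x)) ->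
  (forall x, c / (1 + Rabs x) <= f'' x) ->
  exists C, forall x v, Rabs v <= V -> - C <= f x + v * x.
Proof.
  intros Hc Df Df' Hlow.
  destruct (log_slope_half_line f f' f'' c V Hc Df Df' Hlow) as [C1 H1].
  assert (Dn : forall (g g' : R -> R) x, (forall y, is_derive g y (g' y)) ->
            is_derive (fun y => g (- y)) x (- g' (- x))).
  { intros g g' x Dg.
    replace (- g' (- x)) with (scal (-1) (g' (- x)))
      by (unfold scal; simpl; unfold mult; simpl; ring).
    apply (is_derive_comp g (fun y => - y)); [apply Dg|].
    auto_derive; [exact I | ring]. }
  destruct (log_slope_half_line (fun x => f (- x)) (fun x => - f' (- x))
              (fun x => f'' (- x)) c V Hc) as [C2 H2].
  - intros x; now apply Dn.
  - intros x; rewrite <- (Ropp_involutive (f'' (- x))).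
    apply (is_derive_opp (fun y => f' (- y))); now apply Dn.
  - intros x; rewrite <- (Rabs_Ropp x); apply Hlow.
  - exists (Rmax C1 C2); intros x v Hv.
    apply Rabs_le_between in Hv.
    pose proof (Rmax_l C1 C2); pose proof (Rmax_r C1 C2).
    destruct (Rle_dec 0 x) as [Hx | Hx].
    + pose proof (H1 x v Hx ltac:(lra)); lra.
    + pose proof (H2 (- x) (- v) ltac:(lra) ltac:(lra)) as H3.
      cbv beta in H3; rewrite Ropp_involutive in H3.
      replace (- v * - x) with (v * x) in H3 by ring; lra.
Qed.

(** Since [gamma > 1], the lower bound on [H_pp] dominates [/ C0 / (1 + |p|)],
    which is already not integrable: this makes [H] superlinear in [p]. *)
Lemma hamiltonian_coercive (C0 gamma : R) (Cbar : R -> R) (H : R -> R -> R) (M V : R) :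
  0 < C0 -> 1 < gamma -> assumption_H C0 gamma Cbar H -> 0 < M ->
  exists C, forall p v, Rabs v <= V -> - C <= H p M + v * p.
Proof.
  intros hC0 hgamma hH HM.
  destruct (Ck_partials 3 H (H_C4 _ _ _ _ hH)) as [_ [_ DH]].
  destruct (Ck_partials 3 (D1 H) (Hp_C4 _ _ _ _ hH)) as [_ [_ DHp]].
  apply (log_slope_coercive (fun p => H p M) (fun p => D1 H p M)
           (fun p => D1 (D1 H) p M) (/ C0)).
  - now apply Rinv_0_lt_compat.
  - intros p; exact (proj1 (DH p M HM)).
  - intros p; exact (proj1 (DHp p M HM)).
  - intros p; apply Rle_trans with (2 := Hpp_lower _ _ _ _ hH p M HM).
    apply Rmult_le_compat_l; [now apply Rlt_le, Rinv_0_lt_compat|].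
    pose proof (Rabs_pos p).
    rewrite <- (Rpower_1 (1 + Rabs p)) at 1 by lra.
    rewrite <- Rpower_Ropp.
    apply Rle_Rpower; lra.
Qed.

Lemma density_bound_near_time (m : R -> R -> R) (M t0 : R) :
  (forall x t, continuity_2d_pt m x t) -> (forall t, periodic1 (fun x => m x t)) ->
  (forall x, m x t0 < M) ->
  exists d, 0 < d /\ forall x t, Rabs (t - t0) < d -> m x t <= M.
Proof.
  intros Hc Hp Hlt.
  destruct (periodic_max (fun x => m x t0) (Hp t0)) as [z Hz].
  { intros x; apply continuous_space, Hc. }
  assert (He : 0 < M - m z t0) by (specialize (Hlt z); lra).
  destruct (uniform_continuity_2d m 0 1 (t0 - 1) (t0 + 1) (fun x t _ _ => Hc x t)
              (mkposreal _ He)) as [d Hd]; simpl in Hd.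
  exists (Rmin d 1); split; [apply Rmin_pos; [apply cond_pos | lra]|].
  intros x t Ht.
  pose proof (Rlt_le_trans _ _ _ Ht (Rmin_l _ _)) as Ht1.
  pose proof (Rlt_le_trans _ _ _ Ht (Rmin_r _ _)) as Ht2.
  apply Rabs_def2 in Ht2.
  destruct (periodic_representative (fun x => m x t) 0 x (Hp t)) as [y [Hy Ey]].
  rewrite <- Ey.
  assert (Hclose : Rabs (m y t - m y t0) < M - m z t0).
  { apply Hd; try lra; rewrite Rminus_diag, Rabs_R0; apply cond_pos. }
  apply Rabs_def2 in Hclose; specialize (Hz y); lra.
Qed.

(** Along the segment [s -> (x + v s, t + s)] the solution has derivative
    [u_t + v u_x = H + v p]. *)
Lemma transport_segment (T : R) (H u m p r : R -> R -> R) (v C x t h : R) :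
  mfg_solution T H u m p r -> 0 <= t -> 0 <= h -> t + h <= T ->
  (forall y s, t < s < t + h -> - C <= H (p y s) (m y s) + v * p y s) ->
  u x t - u (x + v * h) (t + h) <= C * h.
Proof.
  intros S Ht Hh HtT Hlow.
  pose (phi := fun s => - u (x + v * s) (t + s) - C * s).
  enough (phi h <= phi 0) as He.
  { unfold phi in He; rewrite !Rmult_0_r, !Rplus_0_r in He; lra. }
  apply (nonincreasing_interior phi
    (fun s => - (p (x + v * s) (t + s) * v
                 + H (p (x + v * s) (t + s)) (m (x + v * s) (t + s)) * 1) - C * 1));
    [exact Hh | | |].
  - intros s _.
    apply (continuous_minus (V := R_NormedModule) (fun s => - u (x + v * s) (t + s)) (fun s => C * s)).
    + apply (continuous_opp (V := R_NormedModule)).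
      apply (continuity_2d_pt_path u (fun s => x + v * s) (fun s => t + s)).
      * apply (mfg_cont_u _ _ _ _ _ _ S).
      * apply (ex_derive_continuous (fun s => x + v * s)); auto_derive; exact I.
      * apply (ex_derive_continuous (fun s => t + s)); auto_derive; exact I.
    + apply (ex_derive_continuous (fun s => C * s)); auto_derive; exact I.
  - intros s Hs.
    apply is_derive_Rminus; [|auto_derive; [exact I | ring]].
    apply (is_derive_opp (fun s => u (x + v * s) (t + s))).
    apply is_derive_Reals.
    apply (derivable_pt_lim_comp_2d u (fun s => x + v * s) (fun s => t + s)).
    + apply filterdiff_differentiable_pt_lim.
      apply (is_derive_filterdiff u _ _ p).
      * apply filter_imp with (fun z : R * R => 0 < snd z < T).
        -- intros [y s'] Hs'; apply (mfg_ux _ _ _ _ _ _ S); exact Hs'.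
        -- assert (Hts : 0 < t + s < T) by lra.
           assert (Hp : 0 < Rmin (t + s) (T - (t + s))) by (apply Rmin_pos; lra).
           exists (mkposreal _ Hp); intros [y s'] [_ Hs']; simpl in Hs'.
           apply Rabs_def2 in Hs'; unfold minus, plus, opp in Hs'; simpl in Hs'.
           pose proof (Rmin_l (t + s) (T - (t + s))); pose proof (Rmin_r (t + s) (T - (t + s))).
           simpl; lra.
      * apply (mfg_HJ _ _ _ _ _ _ S); lra.
      * apply (continuity_2d_pt_filterlim p (x + v * s) (t + s)).
        apply (mfg_cont_p _ _ _ _ _ _ S); lra.
    + apply is_derive_Reals; auto_derive; [exact I | ring].
    + apply is_derive_Reals; auto_derive; [exact I | ring].
  - intros s Hs; specialize (Hlow (x + v * s) (t + s) ltac:(lra)); lra.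
Qed.

(** The density is controlled only near the two ends of the time interval.
    For a step [h] short enough to fit there, [u] and its translate by
    [(v * h, h)] are compared on [[0, T - h]]; both boundary conditions of the
    comparison hold through the bound on [u] itself. *)
Lemma transport_bound (T : R) (H u m p r : R -> R -> R) (M v C x : R) :
  0 < T -> monotone_hamiltonian H -> mfg_solution T H u m p r ->
  (forall y, m y 0 < M) -> (forall y, m y T < M) ->
  (forall q, - C <= H q M + v * q) ->
  u x 0 - u (x + v * T) T <= C * T.
Proof.
  intros HT HH S H0 H1 HC.
  destruct (density_bound_near_time m M 0 (mfg_cont_m _ _ _ _ _ _ S) (mfg_per_m _ _ _ _ _ _ S) H0)
    as [d0 [Hd0 Hb0]].
  destruct (density_bound_near_time m M T (mfg_cont_m _ _ _ _ _ _ S) (mfg_per_m _ _ _ _ _ _ S) H1)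
    as [d1 [Hd1 Hb1]].
  set (d := Rmin (Rmin d0 d1) T).
  assert (Hd : 0 < d) by (repeat apply Rmin_pos; assumption).
  assert (Hdd : d <= d0 /\ d <= d1 /\ d <= T).
  { unfold d; pose proof (Rmin_l (Rmin d0 d1) T); pose proof (Rmin_r (Rmin d0 d1) T).
    pose proof (Rmin_l d0 d1); pose proof (Rmin_r d0 d1); lra. }
  destruct (INR_archimed d T Hd) as [N HN].
  assert (HN0 : 0 < INR N) by nra.
  set (h := T / INR N).
  assert (HNh : INR N * h = T) by (unfold h; field; lra).
  assert (Hh : 0 < h) by now apply Rdiv_lt_0_compat.
  assert (Hhd : h < d) by nra.
  assert (Hlow : forall y s, m y s <= M -> - C <= H (p y s) (m y s) + v * p y s).
  { intros y s Hm.
    pose proof (mono_decreasing H (p y s) (m y s) M HH (mfg_pos _ _ _ _ _ _ S y s) Hm).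
    specialize (HC (p y s)); lra. }
  assert (Hfirst : forall y, u y 0 - u (y + v * h) (0 + h) <= C * h).
  { intros y; apply (transport_segment T H u m p r); try lra; [exact S|].
    intros z s Hs; apply Hlow, Hb0, Rabs_def1; lra. }
  assert (Hlast : forall y, u y (T - h) - u (y + v * h) (T - h + h) <= C * h).
  { intros y; apply (transport_segment T H u m p r); try lra; [exact S|].
    intros z s Hs; apply Hlow, Hb1, Rabs_def1; lra. }
  assert (Hstep : forall y s, 0 <= s <= T - h -> u y s - u (y + v * h) (s + h) <= C * h).
  { assert (S1 : mfg_solution (T - h) H u m p r).
    { destruct S; split; auto; intros y s Hs;
        [apply mfg_cont_p0 | apply mfg_cont_r0 | apply mfg_ux0 | apply mfg_HJ0
        | apply mfg_mt0 | apply mfg_FP0]; lra. }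
    apply (comparison_principle (T - h) H ltac:(lra) HH u m p r _ _ _ _ S1
             (mfg_shift T H u m p r (v * h) h ltac:(lra) S) (C * h)) with (y := 0) (s := 0).
    - intros y; left; apply Hfirst.
    - intros y; left; apply Hlast.
    - lra.
    - apply Hfirst. }
  assert (Hiter : forall n, (n <= N)%nat ->
            u x 0 - u (x + v * (INR n * h)) (INR n * h) <= C * (INR n * h)).
  { induction n as [|n IH]; intros Hn.
    - simpl; rewrite !Rmult_0_l, !Rmult_0_r, Rplus_0_r; lra.
    - rewrite S_INR.
      assert (HnN : INR n + 1 <= INR N) by (rewrite <- S_INR; now apply le_INR).
      specialize (IH ltac:(lia)).
      pose proof (pos_INR n).
      assert (Hlast_step : (INR n + 1) * h <= T)
        by (rewrite <- HNh; apply Rmult_le_compat_r; lra).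
      assert (Hnh : 0 <= INR n * h) by (apply Rmult_le_pos; lra).
      specialize (Hstep (x + v * (INR n * h)) (INR n * h) ltac:(lra)).
      replace (x + v * ((INR n + 1) * h)) with (x + v * (INR n * h) + v * h) by ring.
      replace ((INR n + 1) * h) with (INR n * h + h) by ring; lra. }
  specialize (Hiter N (le_n N)); rewrite HNh in Hiter; exact Hiter.
Qed.
(** * Three comparisons *)

(** As [H] decreases in the density, its values at zero momentum are bounded by
    those near density zero. *)
Lemma hamiltonian_zero_momentum_bounded (H : R -> R -> R) (H00 : Rbar) :
  monotone_hamiltonian H -> filterlim (H 0) (at_right 0) (Rbar_locally H00) ->
  Rbar_lt H00 p_infty -> exists B, forall m, 0 < m -> H 0 m <= B.
Proof.
  intros HH Hlim Hfin.
  assert (Hev : exists B, at_right 0 (fun m => H 0 m <= B)).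
  { destruct H00 as [l | | ].
    - exists (l + 1).
      apply (Hlim (fun y => y <= l + 1)).
      exists (mkposreal 1 Rlt_0_1); intros y Hy.
      apply Rabs_def2 in Hy; unfold minus, plus, opp in Hy; simpl in Hy; lra.
    - destruct Hfin.
    - exists 0; apply (Hlim (fun y => y <= 0)).
      exists 0; intros y Hy; lra. }
  destruct Hev as [B [d Hd]]; exists B; intros m Hm.
  set (n := Rmin m (d / 2)).
  pose proof (cond_pos d) as Hdp.
  assert (Hn : 0 < n) by (apply Rmin_pos; lra).
  apply Rle_trans with (H 0 n).
  - apply mono_decreasing; [exact HH | exact Hn | apply Rmin_l].
  - apply Hd; [|exact Hn].
    pose proof (Rmin_r m (d / 2)) as Hr; fold n in Hr.
    unfold ball; simpl; unfold AbsRing_ball, abs, minus, plus, opp; simpl.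
    apply Rabs_def1; lra.
Qed.

Lemma RInt_zero_exists_nonpos (f : R -> R) :
  (forall x, continuous f x) -> RInt f 0 1 = 0 -> exists y, f y <= 0.
Proof.
  intros Hc HI.
  destruct (continuity_ab_min f 0 1) as [y [Hy _]]; [lra | |].
  { intros c _; apply continuity_pt_filterlim, Hc. }
  exists y; apply Rnot_lt_le; intros Hpos.
  assert (H0 : 0 < RInt f 0 1).
  { apply RInt_gt_0; [lra | | intros x _; apply Hc].
    intros x Hx; apply Rlt_le_trans with (1 := Hpos), Hy; lra. }
  lra.
Qed.

(** Comparison with the constant state of density [mu], vanishing at time [T], at
    the level [(mu + B) / eps].  Wherever [u] exceeds this level at time [T], the
    terminal condition gives [m >= mu + B + mT >= mu]. *)
Lemma terminal_value_bound (T : R) (H u m p r : R -> R -> R) (mT : R -> R) (eps mu B : R) :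
  0 < T -> monotone_hamiltonian H -> mfg_solution T H u m p r ->
  0 < eps -> 0 < mu -> 0 <= mu + B ->
  (forall x, m x 0 <= mu) -> (forall x, - B <= mT x) ->
  (forall x, eps * u x T = m x T - mT x) -> (exists y, u y T <= 0) ->
  forall x, eps * u x T <= mu + B.
Proof.
  intros HT HH S Heps Hmu HmuB H0 HB HTe [y Hy] x.
  assert (HK : eps * ((mu + B) / eps) = mu + B) by (field; lra).
  assert (HK0 : 0 <= (mu + B) / eps) by (apply Rdiv_le_0_compat; lra).
  rewrite <- HK; apply Rmult_le_compat_l; [lra|].
  pose proof (comparison_principle T H HT HH _ _ _ _ _ _ _ _ S
    (mfg_constant_state T H mu T Hmu) ((mu + B) / eps)) as Hcmp; cbv beta in Hcmp.
  specialize (Hcmp (fun z => or_intror (H0 z))).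
  assert (Hz : H 0 mu * (T - T) = 0) by ring.
  enough (u x T - H 0 mu * (T - T) <= (mu + B) / eps) by lra.
  apply Hcmp with (y := y) (s := T); try lra.
  intros z; destruct (Rle_dec (u z T) ((mu + B) / eps)) as [Hle | Hgt]; [left; lra | right].
  apply Rnot_le_lt, (Rmult_lt_compat_l eps) in Hgt; [|exact Heps].
  specialize (HB z); specialize (HTe z); lra.
Qed.

(** Comparison with a constant state whose density is the smallest value of
    [m] at time [T]; at time [0] the difference is below its level. *)
Lemma terminal_le_initial_max (T : R) (H u m p r : R -> R -> R) (B : R) :
  0 < T -> monotone_hamiltonian H -> mfg_solution T H u m p r ->
  (forall n, 0 < n -> H 0 n <= B) ->
  exists z, forall x, u x T <= u z 0 + B * T.
Proof.
  intros HT HH S HB.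
  destruct (periodic_max (fun x => u x 0)) as [z Hz].
  { apply (mfg_per_u _ _ _ _ _ _ S). }
  { intros x; apply continuous_space, (mfg_cont_u _ _ _ _ _ _ S). }
  destruct (periodic_min (fun x => m x T)) as [q Hq].
  { apply (mfg_per_m _ _ _ _ _ _ S). }
  { intros x; apply continuous_space, (mfg_cont_m _ _ _ _ _ _ S). }
  assert (Hnu : 0 < m q T) by apply (mfg_pos _ _ _ _ _ _ S).
  exists z; intros x.
  pose proof (comparison_principle T H HT HH _ _ _ _ _ _ _ _ S
    (mfg_constant_state T H (m q T) 0 Hnu) (u z 0)) as Hcmp; cbv beta in Hcmp.
  assert (Hc : u x T - H 0 (m q T) * (T - 0) <= u z 0).
  { apply Hcmp with (y := z) (s := 0); try lra.
    - intros y; left; specialize (Hz y); lra.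
    - intros y; right; apply Hq. }
  specialize (HB (m q T) Hnu); nra.
Qed.

Lemma C2_Holder_continuous (alpha : R) (f : R -> R) (x : R) :
  C2_Holder alpha f -> continuous f x.
Proof.
  intros [_ [Hd _]]; apply (ex_derive_continuous f).
  exact (Hd 1%nat x ltac:(lia)).
Qed.

Theorem proposition4p5
  (C0 gamma alpha : R) (Cbar : R -> R)
  (hC0 : 0 < C0) (hgamma : 1 < gamma) (halpha : 0 < alpha < 1)
  (hCbar_pos : forall m : R, 0 < m -> 0 < Cbar m)
  (hCbar_cont : forall m : R, 0 < m -> continuous Cbar m)
  (T : R) (hT : 0 < T)
  (H : R -> R -> R) (m0 mT : R -> R)
  (hM : assumption_M' alpha m0 mT)
  (hH : assumption_H C0 gamma Cbar H)
  (hE : assumption_E C0 H)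
  (H00 : Rbar) (hH00 : filterlim (H 0) (at_right 0) (Rbar_locally H00))
  (hH00_fin : Rbar_lt H00 p_infty)
  (x0 : R) (hx0 : mT x0 < 0) :
  exists C : R, 0 < C /\
    forall eps : R, 0 < eps < 1 / C ->
      ~ (exists u m : R -> R -> R, classical_solution T H m0 mT eps u m).
Proof.
  pose proof (assumption_H_monotone C0 gamma Cbar H hC0 hH hE) as HH.
  destruct (hamiltonian_zero_momentum_bounded H H00 HH hH00 hH00_fin) as [B0 HB0].
  pose proof (fun x => C2_Holder_continuous alpha m0 x (M'_m0_reg _ _ _ hM)) as Cm0.
  pose proof (fun x => C2_Holder_continuous alpha mT x (M'_mT_reg _ _ _ hM)) as CmT.
  destruct (periodic_max m0 (proj1 (M'_m0_reg _ _ _ hM)) Cm0) as [z0 Hz0].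
  destruct (periodic_min mT (proj1 (M'_mT_reg _ _ _ hM)) CmT) as [z1 Hz1].
  destruct (periodic_max mT (proj1 (M'_mT_reg _ _ _ hM)) CmT) as [z2 Hz2].
  set (mu := m0 z0) in *.
  set (B := - mT z1).
  assert (Hmu : 0 < mu) by apply (M'_m0_pos _ _ _ hM).
  assert (HB : 0 < B) by (specialize (Hz1 x0); unfold B; lra).
  (* A strict bound, uniform in [eps], for the density at both end times. *)
  set (M := mu + B + Rmax (mT z2) 0 + 1).
  assert (HM : mu < M /\ mu + B + mT z2 < M).
  { unfold M; pose proof (Rmax_l (mT z2) 0); pose proof (Rmax_r (mT z2) 0); lra. }
  (* The point [y] can be moved into the period following [z], so the speeds
     needed to join them in time [T] are at most [/ T]. *)
  destruct (hamiltonian_coercive C0 gamma Cbar H M (/ T) hC0 hgamma hH ltac:(lra))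
    as [C1 HC1].
  set (K := (B0 + C1) * T).
  set (delta := - mT x0).
  assert (Hdelta : 0 < delta) by (unfold delta; lra).
  pose proof (Rabs_pos K) as HK.
  exists ((Rabs K + 1) / delta); split; [apply Rdiv_lt_0_compat; lra|].
  intros eps [Heps Heps1] [u [m S]].
  destruct (classical_mfg_solution T H m0 mT eps u m hT
    ltac:(do 3 apply Ck_pred; apply hH) S) as [p [r S']].
  set (u' := fun x t => u x (clamp T t)) in S'.
  set (m' := fun x t => m x (clamp T t)) in S'.
  assert (Hinit : forall x, m' x 0 = m0 x).
  { intros x; unfold m'; rewrite clamp_id by lra; apply (sol_init _ _ _ _ _ _ _ S). }
  assert (Hterm : forall x, eps * u' x T = m' x T - mT x).
  { intros x; unfold u', m'; rewrite clamp_id by lra; apply (sol_term _ _ _ _ _ _ _ S). }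
  assert (Cm' : forall x, continuous (fun x => m' x T) x).
  { intros x; apply continuous_space, (mfg_cont_m _ _ _ _ _ _ S'). }
  assert (Hneg : exists y, u' y T <= 0).
  { destruct (RInt_zero_exists_nonpos (fun x => m' x T - mT x)) as [y Hy].
    - intros x; apply (continuous_minus (V := R_NormedModule)); [apply Cm' | apply CmT].
    - pose proof (RInt_minus (fun x => m' x T) mT 0 1
        (ex_RInt_cont _ 0 1 Cm') (ex_RInt_cont _ 0 1 CmT)) as Hm.
      change (RInt (fun x => m' x T - mT x) 0 1
        = RInt (fun x => m' x T) 0 1 - RInt mT 0 1) in Hm.
      rewrite Hm, <- (mfg_mass T H u' m' p r hT S'), (M'_mT_mass _ _ _ hM).
      rewrite (RInt_ext _ m0) by (intros x _; apply Hinit).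
      rewrite (M'_m0_mass _ _ _ hM); exact (Rminus_diag 1).
    - exists y; rewrite <- Hterm in Hy; nra. }
  assert (HuT : forall x, eps * u' x T <= mu + B).
  { apply (terminal_value_bound T H u' m' p r mT eps mu B); auto; try lra.
    - intros x; rewrite Hinit; apply Hz0.
    - intros x; specialize (Hz1 x); unfold B; lra. }
  destruct (terminal_le_initial_max T H u' m' p r B0 hT HH S' HB0) as [z Hz].
  destruct Hneg as [y0 Hy0].
  destruct (periodic_representative (fun x => u' x T) z y0 (mfg_per_u _ _ _ _ _ _ S' T))
    as [y [Hy Ey]].
  assert (Htr : u' z 0 - u' (z + (y - z) / T * T) T <= C1 * T).
  { apply (transport_bound T H u' m' p r M); auto.
    - intros x; rewrite Hinit; specialize (Hz0 x); lra.
    - intros x; specialize (HuT x); specialize (Hterm x); specialize (Hz2 x); lra.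
    - intros q; apply HC1.
      unfold Rdiv; rewrite Rabs_mult, Rabs_inv, (Rabs_pos_eq T) by lra.
      rewrite <- (Rmult_1_l (/ T)) at 2; apply Rmult_le_compat_r.
      + now apply Rlt_le, Rinv_0_lt_compat.
      + apply Rabs_le; lra. }
  replace (z + (y - z) / T * T) with y in Htr by (field; lra).
  specialize (Hz x0).
  assert (Hfin : u' x0 T <= K) by (unfold K; lra).
  pose proof (mfg_pos _ _ _ _ _ _ S' x0 T) as Hpos.
  specialize (Hterm x0).
  assert (Hlow : delta < eps * (Rabs K + 1)).
  { apply Rlt_le_trans with (eps * u' x0 T); [unfold delta; lra|].
    apply Rmult_le_compat_l; [lra|].
    pose proof (Rle_abs K); lra. }
  apply (Rmult_lt_compat_r (Rabs K + 1)) in Heps1; [|lra].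
  replace (1 / ((Rabs K + 1) / delta) * (Rabs K + 1)) with delta in Heps1 by (field; lra).
  lra.
Qed.
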